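(* (1) $OMCUT_4$ has exactly $74$ extreme rays, generated by the non-zero oriented multi-cuts on $V_4$. Under $\mathbb{Z}_2\times Sym(4)$ they form exactly $5$ orbits, represented by $\delta'(\{4\},\{1,2,3\})$, $\delta'(\{4,3\},\{2,1\})$, $\delta'(\{4\},\{3\},\{2,1\})$, $\delta'(\{4\},\{3,2\},\{1\})$ and $\delta'(\{4\},\{3\},\{2\},\{1\})$. (2) $OMCUT_4$ has exactly $72$ facets, forming exactly $4$ orbits. They are induced by the $24$ oriented triangle inequalities $OT_{ij,k}$, the $12$ non-negativity inequalities $NN_{ij}$, the $12$ inequalities $A_4(i_1,i_2;j_1,j_2)$ and the $24$ inequalities $B_4(i_1,i_2;j_1,j_2)$. Here $\{i_1,i_2,j_1,j_2\}=V_4$, and inequalities with the same coefficient vector up to a positive factor are identified and counted once. (3) $QMET_4$ has exactly $36$ facets, forming exactly two orbits: the $24$ oriented triangle facets and the $12$ non-negativity facets. (4) $QMET_4$ has exactly $164$ extreme rays, forming exactly $10$ orbits: the $5$ orbits of oriented multi-cuts in (1), and $5$ further orbits represented by the following vectors, with coordinates listed in the order $(d_{12},d_{13},d_{14},d_{21},d_{23},d_{24},d_{31},d_{32},d_{34},d_{41},d_{42},d_{43})$: $(0,0,0,1,0,0,1,1,0,2,1,1)$, $(0,0,0,1,0,0,1,1,1,1,1,1)$, $(0,0,0,1,0,1,1,1,1,1,1,0)$, $(0,0,1,1,1,1,1,1,1,1,0,0)$ and $(0,0,1,1,1,1,1,1,2,1,0,0)$.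
   Context: Let $V_n=\{1,\dots,n\}$. Vectors $d=(d_{ij})_{1\le i\ne j\le n}$ in $\mathbb{R}^{n(n-1)}$ are identified with $n\times n$ matrices with zero diagonal. $QMET_n\subset\mathbb{R}^{n(n-1)}$ is the cone of all $d$ satisfying the oriented triangle inequalities $OT_{ij,k}: d_{ik}+d_{kj}-d_{ij}\ge 0$ (for $i,j,k$ distinct) and the non-negativity inequalities $NN_{ij}: d_{ij}\ge 0$ (for $i\neq j$). For an ordered partition $(S_1,\dots,S_q)$ of $V_n$ into $q\ge 2$ non-empty parts, the oriented multi-cut $\delta'(S_1,\dots,S_q)$ is the vector with $\delta'(S_1,\dots,S_q)_{ij}=1$ if $i\in S_\alpha$, $j\in S_\beta$ with $\alpha<\beta$, and $0$ otherwise. $OMCUT_n$ is the convex cone generated by all non-zero oriented multi-cuts on $V_n$. For $V_4=\{c_1,c_2,a,b\}$: - $A_4(c_1,c_2;a,b)$ is the inequality $d_{ac_1}+d_{ac_2}+d_{c_1b}+d_{c_2b}+d_{ba}-d_{ab}-d_{c_1c_2}-d_{c_2c_1}\ge 0$; - $B_4(c_1,c_2;a,b)$ is the inequality $\sum_{i=1}^{2}(d_{c_ia}+d_{ac_i}+d_{c_ib})-d_{ab}-d_{c_1c_2}-d_{c_2c_1}\ge 0$. An extreme ray of a cone is a face of dimension $1$; a facet is a face of codimension $1$. Orbits are taken under the group $\mathbb{Z}_2\times Sym(n)$, which acts by permuting the points of $V_n$ and by the reversal $d\mapsto d^r$, $d^r_{ij}=d_{ji}$ (acting in the same way on coefficient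 vectors of inequalities).
   Formalization: B_4(c_1,c_2;a,b) is symmetric in c_1,c_2, so it gives only 12 inequalities up to a positive factor, not 24; the family of 24 inequalities B_4 is taken to consist of these 12 together with their 12 reversals. *)

(* Defs.v *)
From mathcomp Require Import all_boot all_order all_algebra all_fingroup.
From mathcomp Require Import boolp classical_sets functions cardinality reals.

Set Implicit Arguments.
Unset Strict Implicit.
Unset Printing Implicit Defensive.

Import Order.TTheory GRing.Theory Num.Theory.

Local Open Scope classical_set_scope.
Local Open Scope ring_scope.

(* R^{n(n-1)} is the space of matrices in 'M[R]_n with zero diagonal; the set
   V_n = {1, .., n} is represented by 'I_n (the point k is the ordinal k-1). *)

Section Cones.
Variables (R : realFieldType) (n : nat).
Local Notation V := 'M[R]_n.
Implicit Types (C F S : set V) (a v : V).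

Definition zero_diag : set V := [set d | forall i, d i i = 0].

Definition pairing (a d : V) : R := \sum_i \sum_(j | j != i) a i j * d i j.

Definition conic_hull S : set V :=
  [set d | exists (k : nat) (c : 'I_k -> R) (g : 'I_k -> V),
     [/\ forall i, 0 <= c i, forall i, S (g i) & d = \sum_i c i *: g i]].

Definition ray v : set V := [set t *: v | t in [set t : R | 0 <= t]].

(* The dimension of the linear span of S, i.e. S contains a basis of its span.
   For cones and their faces, which contain 0, this is the usual dimension. *)
Definition has_dim S (k : nat) : Prop :=
  exists X : seq V, [/\ forall x, x \in X -> S x, free X, size X = k
                      & forall x, S x -> x \in <<X>>%VS].

Definition valid C a : Prop := forall d, C d -> 0 <= pairing a d.

(* the part of C on which the inequality 0 <= pairing a d is an equality *)
Definition induced C a : set V := [set d | C d /\ pairing a d = 0].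

Definition face C F : Prop := exists a, valid C a /\ F = induced C a.

Definition extreme_rays C : set (set V) := [set F | face C F /\ has_dim F 1].

Definition facets C : set (set V) :=
  [set F | face C F /\ exists k, has_dim C k.+1 /\ has_dim F k].

(* the coefficient vectors that define the same inequality as a *)
Definition ineq_class a : set V := [set t *: a | t in [set t : R | 0 < t]].

(* (true, 1) is the reversal *)
Definition sym_act (g : bool * 'S_n) (d : V) : V :=
  \matrix_(i, j) (if g.1 then d (g.2 j) (g.2 i) else d (g.2 i) (g.2 j)).

Definition orbit_set F : set (set V) := [set sym_act g @` F | g in setT].

Definition orbits (FF : set (set V)) : set (set (set V)) :=
  [set orbit_set F | F in FF].

End Cones.

Section Families.
Variables (R : realFieldType) (n : nat).
Local Notation V := 'M[R]_n.

Definition QMET : set V :=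
  [set d | [/\ zero_diag d,
     forall i j k : 'I_n, uniq [:: i; j; k] -> 0 <= d i k + d k j - d i j
   & forall i j : 'I_n, i != j -> 0 <= d i j]].

Definition ordered_partition (s : seq {set 'I_n}) : bool :=
  uniq s && finset.partition [set X in s]%SET [set: 'I_n]%SET.

Definition multicut (s : seq {set 'I_n}) : V :=
  \matrix_(i, j) [exists p : 'I_(size s), exists q : 'I_(size s),
     [&& (p < q)%N, i \in nth finset.set0 s p & j \in nth finset.set0 s q]]%:R.

Definition nonzero_multicuts : set V :=
  [set d | d != 0 /\ exists s : seq {set 'I_n},
     [/\ ordered_partition s, (2 <= size s)%N & d = multicut s]].

Definition OMCUT : set V := conic_hull nonzero_multicuts.

(* Coefficient vectors of the inequalities: e i j is the coordinate form
   d |-> d i j. *)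
Local Notation e i j := (delta_mx i j : V).

Definition OT (i j k : 'I_n) : V := e i k + e k j - e i j.

Definition NN (i j : 'I_n) : V := e i j.

Definition A4 (c1 c2 a b : 'I_n) : V :=
  e a c1 + e a c2 + e c1 b + e c2 b + e b a - e a b - e c1 c2 - e c2 c1.

Definition B4 (c1 c2 a b : 'I_n) : V :=
  (e c1 a + e a c1 + e c1 b) + (e c2 a + e a c2 + e c2 b)
  - e a b - e c1 c2 - e c2 c1.

Definition OT_ineqs : set V :=
  [set x | exists i j k : 'I_n, uniq [:: i; j; k] /\ x = OT i j k].

Definition NN_ineqs : set V :=
  [set x | exists i j : 'I_n, i != j /\ x = NN i j].

Definition A4_ineqs : set V :=
  [set x | exists c1 c2 a b : 'I_n,
     uniq [:: c1; c2; a; b] /\ x = A4 c1 c2 a b].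

(* For n = 4 the coefficient vectors B4 c1 c2 a b only number 12, since c1 and
   c2 play symmetric roles, and they are not stable under reversal; the family
   of 24 inequalities also contains the reversed ones. *)
Definition B4_ineqs : set V :=
  [set x | exists c1 c2 a b : 'I_n, uniq [:: c1; c2; a; b] /\
     (x = B4 c1 c2 a b \/ x = (B4 c1 c2 a b)^T)].

End Families.

Arguments QMET R n : clear implicits.
Arguments nonzero_multicuts R n : clear implicits.
Arguments OMCUT R n : clear implicits.
Arguments OT_ineqs R n : clear implicits.
Arguments NN_ineqs R n : clear implicits.
Arguments A4_ineqs R n : clear implicits.
Arguments B4_ineqs R n : clear implicits.

Section Four.
Variable R : realFieldType.

Definition pt (k : nat) : 'I_4 := inord k.-1.

Definition multicut_reps : seq 'M[R]_4 :=
  [:: multicut R [:: [set pt 4]%SET; [set pt 1; pt 2; pt 3]%SET];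
      multicut R [:: [set pt 4; pt 3]%SET; [set pt 2; pt 1]%SET];
      multicut R [:: [set pt 4]%SET; [set pt 3]%SET; [set pt 2; pt 1]%SET];
      multicut R [:: [set pt 4]%SET; [set pt 3; pt 2]%SET; [set pt 1]%SET];
      multicut R [:: [set pt 4]%SET; [set pt 3]%SET; [set pt 2]%SET;
                     [set pt 1]%SET]].

(* s lists the off-diagonal entries row by row: d12, d13, d14, d21, .., d43;
   unbump i j is the rank of j among the three indices other than i. *)
Definition mx_of_coords (s : seq nat) : 'M[R]_4 :=
  \matrix_(i, j) (if i == j then 0 else (nth 0%N s (3 * i + unbump i j))%:R).

Definition other_reps : seq 'M[R]_4 :=
  [:: mx_of_coords [:: 0; 0; 0; 1; 0; 0; 1; 1; 0; 2; 1; 1]%N;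
      mx_of_coords [:: 0; 0; 0; 1; 0; 0; 1; 1; 1; 1; 1; 1]%N;
      mx_of_coords [:: 0; 0; 0; 1; 0; 1; 1; 1; 1; 1; 1; 0]%N;
      mx_of_coords [:: 0; 0; 1; 1; 1; 1; 1; 1; 1; 1; 0; 0]%N;
      mx_of_coords [:: 0; 0; 1; 1; 1; 1; 1; 1; 2; 1; 0; 0]%N].

End Four.

(* Main.v *)
(* For a cone C cut out by inequalities A, say that a list G of points of C
   meets every face if each nonzero x in C has a g in G on which every
   inequality tight at x is tight.  Subtracting from x the largest multiple of
   g that stays in C makes one more inequality tight, so G then generates C.
   This property survives the addition of an inequality a, provided that
   for all g, h on opposite sides of a some new generator is tight on a and on
   everything tight at both g and h: this is the double description method,
   and the nonadjacent pairs need no separate argument because a pair already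
   dominated by another generator can simply be dropped.  Running the method
   from the orthant through the oriented triangle inequalities gives the 164
   rays of QMET_4, and continuing through A_4 and B_4 gives the 74 multi-cuts.

   Given such a pair (A, G), a generator spans an extreme ray as soon as no
   other generator satisfies all the inequalities tight at it with equality.
   An inequality induces a facet as soon as there is a flag of faces below it:
   picking one generator at each step gives a triangular incidence matrix,
   hence 11 independent vectors.  Conversely a face of dimension 11 lies in the
   zero set of some inequality of A, since otherwise the sum of a basis of it
   would be an interior point.  Orbits are then computed on coordinates. *)
From HB Require Import structures.
Require Import Defs.
From mathcomp Require Import all_boot all_order all_algebra all_fingroup.
From mathcomp Require Import boolp classical_sets functions cardinality reals.
From mathcomp Require Import zify.

Set Implicit Arguments.
Unset Strict Implicit.
Unset Printing Implicit Defensive.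

Import Order.TTheory GRing.Theory Num.Theory.

Local Open Scope classical_set_scope.
Local Open Scope ring_scope.

(** * Polyhedral cones *)

Lemma argmin_seq (R : realFieldType) (T : eqType) (f : T -> R) (s : seq T) (y : T) : y \in s ->
  exists2 x, x \in s & forall z, z \in s -> f x <= f z.
Proof.
elim: s y => // z s IH y _; have [->|/eqP] := eqVneq s [::].
  by exists z => [|w]; rewrite inE // => /eqP->.
case: s IH => // w s IH _; have [x xs xm] := IH w (mem_head _ _).
have [le|/ltW le] := leP (f z) (f x).
  exists z => [|u]; rewrite ?mem_head // inE => /predU1P[->//|/xm].
  exact: le_trans.
by exists x => [|u]; rewrite inE ?xs ?orbT // => /predU1P[->//|/xm].
Qed.

Lemma ltn_count (T : eqType) (p q : pred T) (s : seq T) (x : T) :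
  {in s, forall y, p y -> q y} -> x \in s -> q x -> ~~ p x ->
  (count p s < count q s)%N.
Proof.
move=> pq xs qx px; rewrite -(size_filter q) -(count_predC (pred1 x)).
rewrite !count_filter -[count p s]add0n -addSn leq_add //.
  by rewrite -has_count; apply/hasP; exists x; rewrite //= eqxx.
set r := predI _ _; rewrite (@eq_in_count _ p (predI p r)) => [|y /pq H /=].
  by apply: sub_count => y /andP[].
case: (boolP (p y)) => //= py; rewrite H ?andbT //.
by apply/esym; apply: contraNneq px => <-.
Qed.

Section Polyhedral.
Variables (R : realFieldType) (n : nat).
Local Notation V := 'M[R]_n.
Implicit Types (A G X : seq V) (a b g h x y : V).

Lemma pairing_is_scalar a : scalar (@pairing R n a).
Proof.
move=> c x y; rewrite /pairing mulr_sumr -big_split; apply: eq_bigr => i _.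
rewrite /= mulr_sumr -big_split; apply: eq_bigr => j _.
by rewrite !mxE mulrDr mulrCA.
Qed.

HB.instance Definition _ a :=
  GRing.isLinear.Build R V R *%R (pairing a) (pairing_is_scalar a).

Lemma pairingC a x : pairing a x = pairing x a.
Proof.
by apply: eq_bigr => i _; apply: eq_bigr => j _; rewrite mulrC.
Qed.

Lemma pairing_delta i j x : i != j -> pairing (delta_mx i j) x = x i j.
Proof.
move=> ij; rewrite /pairing (bigD1 i) //= (bigD1 j) /=; last by rewrite eq_sym.
rewrite mxE !eqxx mul1r !big1 ?addr0 // => k.
  by move=> ki; rewrite big1 // => l _; rewrite mxE (negbTE ki) mul0r.
by case/andP=> _ kj; rewrite mxE (negbTE kj) andbF mul0r.
Qed.

Definition hcone A : set V :=
  [set d | zero_diag d /\ forall a, a \in A -> 0 <= pairing a d].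

Lemma hcone_lin A x y (s : R) : hcone A x -> zero_diag y ->
  (forall a, a \in A -> - s * pairing a y <= pairing a x) -> hcone A (x + s *: y).
Proof.
move=> [x0 xA] y0 H; split=> [i|a aA]; first by rewrite !mxE x0 y0 mulr0 addr0.
by rewrite linearD linearZ /= -lerBlDr sub0r -mulNr H.
Qed.

(* [carries A x g]: g lies in the smallest face of [hcone A] containing x. *)
Definition carries A x g :=
  forall a, a \in A -> pairing a x = 0 -> pairing a g = 0.

Definition meets_faces A G :=
  forall x, hcone A x -> x != 0 -> exists2 g, g \in G & carries A x g.

(** [gen_pos] makes each generator nonzero and also bounds the multiples of it that can be
    subtracted without leaving the cone. *)
Record generates A G : Prop := Generates {
  gen_in : forall g, g \in G -> hcone A g;
  gen_pos : forall g, g \in G -> exists2 a, a \in A & 0 < pairing a g;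
  gen_faces : meets_faces A G }.

Section Generated.
Variables (A G : seq V).
Hypothesis AG : generates A G.

Lemma gen_neq0 g : g \in G -> g != 0.
Proof.
case/(gen_pos AG) => a _; apply: contraTneq => ->.
by rewrite linear0 ltxx.
Qed.

(* Subtract from x the largest multiple of a generator of its smallest face
   that stays in the cone: one more inequality becomes tight. *)
Lemma decomp x : hcone A x ->
  exists c : 'I_(size G) -> R,
    (forall i, 0 <= c i) /\ x = \sum_i c i *: G`_i.
Proof.
have [m] := ubnP (count (fun a => pairing a x != 0) A).
elim: m x => // m IH x lem xA.
have [->|x0] := eqVneq x 0.
  by exists (fun=> 0); split=> //; rewrite big1 // => i _; rewrite scale0r.
have [g gG cg] := gen_faces AG xA x0.
have [g0 gA] := gen_in AG gG.
have [b bA bg] := gen_pos AG gG.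
(* Ratio test: only inequalities positive on [g] limit the multiple, and the smallest ratio [f a] is
   the largest multiple allowed. [gen_pos] ensures that there is such an inequality. *)
pose f a := pairing a x / pairing a g.
have [|a] := @argmin_seq _ _ f [seq a <- A | 0 < pairing a g] b.
  by rewrite mem_filter bg.
rewrite mem_filter => /andP[ag aA] amin.
have fa0 : 0 <= f a by rewrite divr_ge0 ?(ltW ag) ?xA.2.
have yA : hcone A (x + (- f a) *: g).
  apply: hcone_lin => // d dA; rewrite opprK.
  have := gA _ dA; rewrite le0r => /predU1P[->|dg]; first by rewrite mulr0 xA.2.
  by rewrite -ler_pdivlMr // amin // mem_filter dg.
have [|c [c0 xE]] := IH _ _ yA.
  rewrite ltnS in lem; apply: leq_trans lem.
  apply: (@ltn_count _ _ _ _ a) => //.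
  - move=> d dA; apply: contraNneq => dx.
    by rewrite linearD linearZ /= dx (cg _ dA dx) mulr0 addr0.
  - by apply: contraTneq ag => /(cg _ aA) ->; rewrite ltxx.
  - by rewrite negbK linearD linearZ /= /f mulNr divfK ?subrr // gt_eqF.
have ig : (index g G < size G)%N by rewrite index_mem.
exists (fun i => c i + (i == Ordinal ig)%:R * f a); split=> [i|].
  by rewrite addr_ge0 // mulr_ge0 // ler0n.
under eq_bigr do rewrite scalerDl; rewrite big_split /= -xE.
rewrite (bigD1 (Ordinal ig)) //= big1 => [|i /negbTE->]; last first.
  by rewrite mul0r scale0r.
by rewrite eqxx mul1r nth_index // addr0 scaleNr subrK.
Qed.

Lemma hcone_hull : hcone A = conic_hull [set` G].
Proof.
apply/seteqP; split=> [x /decomp[c [c0 ->]]|x [k [c [f [c0 fG ->]]]]].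
  by exists (size G), c, (fun i => G`_i); split=> // i /=; rewrite mem_nth.
split=> [i|a aA].
  rewrite summxE big1 // => j _; have [z _] := gen_in AG (fG j).
  by rewrite mxE z mulr0.
rewrite linear_sum /= sumr_ge0 // => i _; rewrite linearZ /= mulr_ge0 //.
by have [_ H] := gen_in AG (fG i); exact: H.
Qed.

(** A sum of non-negative terms vanishes only if every term does. *)
Lemma decomp_tight (c : 'I_(size G) -> R) a :
  (forall i, 0 <= c i) -> (forall g, g \in G -> 0 <= pairing a g) ->
  pairing a (\sum_i c i *: G`_i) = 0 ->
  forall i, c i != 0 -> pairing a G`_i = 0.
Proof.
move=> c0 aG; rewrite linear_sum /= => S0 i ci.
have /psumr_eq0P/(_ S0)/(_ i isT) :
    forall j : 'I_(size G), true -> 0 <= pairing a (c j *: G`_j).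
  by move=> j _; rewrite linearZ mulr_ge0 // aG ?mem_nth.
by move/eqP; rewrite linearZ /= mulf_eq0 (negbTE ci) => /eqP.
Qed.

Lemma decomp_carries (c : 'I_(size G) -> R) :
  (forall i, 0 <= c i) ->
  forall i, c i != 0 -> carries A (\sum_i c i *: G`_i) G`_i.
Proof.
move=> c0 i ci a aA ax; apply: decomp_tight ax _ ci => // g gG.
by have [_ H] := gen_in AG gG; exact: H.
Qed.

(** The double description step. Decompose [x] over the old generators, all of which lie in its
    smallest face. If some generator used lies on the right side of [a], and on [a] whenever [x]
    does, its replacement in [G'] works. Otherwise [x] lies on [a] and generators on both sides are
    used, so the element attached to such a pair works. *)
Lemma meets_faces_cons a G' :
  (forall g, g \in G -> 0 <= pairing a g ->
     exists2 g', g' \in G' & carries (a :: A) g g') ->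
  (forall g h, g \in G -> h \in G -> 0 < pairing a g -> pairing a h < 0 ->
     exists2 g', g' \in G' & pairing a g' = 0 /\
       (forall b, b \in A -> pairing b g = 0 -> pairing b h = 0 ->
          pairing b g' = 0)) ->
  meets_faces (a :: A) G'.
Proof.
move=> Hnn Hpn x [x0 xA] xn0.
have hx : hcone A x by split=> // b bA; rewrite xA // inE bA orbT.
have ax0 := xA _ (mem_head _ _).
have [c [c0 xE]] := decomp hx.
have carr i : c i != 0 -> carries A x G`_i.
  by rewrite xE; exact: decomp_carries.
have axE : pairing a x = \sum_i c i * pairing a G`_i.
  by rewrite xE linear_sum; apply: eq_bigr => i _; rewrite linearZ.
have single i : c i != 0 -> 0 <= pairing a G`_i ->
    (pairing a x = 0 -> pairing a G`_i = 0) ->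
    exists2 g, g \in G' & carries (a :: A) x g.
  move=> ci ai ci0; have [||g' gG' cg'] := Hnn G`_i; rewrite ?mem_nth //.
  exists g' => // b bA bx; apply: cg' => //; move: bA.
  by rewrite inE => /predU1P[ba|bA]; [rewrite ba ci0 // -ba | apply: carr bx].
have cneq0 i : c i * pairing a G`_i != 0 -> c i != 0.
  by rewrite mulf_eq0 negb_or => /andP[].
have [axp|axn] := ltP 0 (pairing a x).
  have [|no] := pselect (exists i, 0 < c i * pairing a G`_i).
    case=> i cai; have ci := cneq0 i (lt0r_neq0 cai).
    apply: (single i) => //; last by move=> ax; rewrite ax ltxx in axp.
    by rewrite ltW // -(pmulr_rgt0 _ (x := c i)) // lt_def ci c0.
  suff : pairing a x <= 0 by rewrite leNgt axp.
  rewrite axE sumr_le0 // => i _; rewrite leNgt; apply/negP => ?.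
  by apply: no; exists i.
have ax : pairing a x = 0 by apply/le_anti/andP.
have [[i ci ai]|no] := pselect (exists2 i, c i != 0 & pairing a G`_i = 0).
  by apply: (single i) => //; rewrite ai.
have [i ci] : exists i, c i != 0.
  apply: contrapT => H; case/eqP: xn0; rewrite xE big1 // => i _.
  have [->|ci] := eqVneq (c i) 0; first by rewrite scale0r.
  by case: H; exists i.
(* Taken at 1 and -1, this gives a generator on each side of [a]. If one side were missing, the
   terms of the zero sum [pairing a x] would share a sign, hence all vanish, against [no]. *)
have sign_change (s : R) : s != 0 -> exists2 j, c j != 0 & 0 < s * pairing a G`_j.
  move=> s0; apply: contrapT => H.
  have neg j : 0 <= - s * (c j * pairing a G`_j).
    have [->|cj] := eqVneq (c j) 0; first by rewrite mul0r mulr0.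
    rewrite mulrCA mulr_ge0 // mulNr oppr_ge0 leNgt; apply/negP => ?.
    by apply: H; exists j.
  have /psumr_eq0P : forall j : 'I_(size G), true -> 0 <= - s * (c j * pairing a G`_j) by [].
  rewrite -mulr_sumr -axE ax mulr0 => /(_ erefl) /(_ i isT) /eqP.
  rewrite !mulf_eq0 oppr_eq0 (negbTE s0) (negbTE ci) /= => /eqP ai.
  by apply: no; exists i.
have [j cj] := sign_change 1 (oner_neq0 _); rewrite mul1r => aj.
have m1 : -1 != 0 :> R by rewrite oppr_eq0 oner_neq0.
have [k ck] := sign_change (-1) m1; rewrite mulN1r oppr_gt0 => ak.
have [||||g' gG' [ag' cg']] := Hpn G`_j G`_k; rewrite ?mem_nth //.
exists g' => // b; rewrite inE => /predU1P[->//|bA bx].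
by apply: cg' => //; [exact: (carr j cj)|exact: (carr k ck)].
Qed.

Lemma ray_has_dim1 g : g != 0 -> has_dim (ray g) 1.
Proof.
move=> g0; exists [:: g]; split=> //; last first.
- by move=> _ [t _ <-]; rewrite span_seq1 memvZ // memv_line.
- by rewrite seq1_free.
- by move=> x; rewrite inE => /eqP->; exists 1 => /=; rewrite ?ler01 ?scale1r.
Qed.

Lemma extreme_rays_hcone :
  (forall g h, g \in G -> h \in G -> carries A g h -> h = g) ->
  extreme_rays (hcone A) = [set ray g | g in [set` G]].
Proof.
move=> Gmax; apply/seteqP; split=> [F [[a [aV ->]] [X [XF Xfree sX FX]]]|_ [g /= gG <-]].
  case: X sX XF Xfree FX => [|x []] // _ XF; rewrite seq1_free span_seq1 => xn0 FX.
  have [xA ax] := XF _ (mem_head _ _).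
  have aG g : g \in G -> 0 <= pairing a g by move/(gen_in AG)/aV.
  have [c [c0 xE]] := decomp xA.
  have [i ci] : exists i, c i != 0.
    apply: contrapT => H; case/eqP: xn0; rewrite xE big1 // => i _.
    have [->|ci] := eqVneq (c i) 0; first by rewrite scale0r.
    by case: H; exists i.
  have gG : G`_i \in G by rewrite mem_nth.
  have ag : pairing a G`_i = 0 by apply: decomp_tight ci => //; rewrite -xE.
  have gA := gen_in AG gG.
  exists G`_i => //; apply/seteqP; split=> [_ [t /= t0 <-]|d [dA ad]].
    split; last by rewrite linearZ /= ag mulr0.
    split=> [k|b bA]; first by rewrite mxE gA.1 mulr0.
    by rewrite linearZ /= mulr_ge0 // gA.2.
  have /vlineP[s gE] := FX G`_i (conj gA ag).
  have s0 : s != 0.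
    by have := gen_neq0 gG; rewrite gE scaler_eq0 negb_or => /andP[].
  have /vlineP[t dE] := FX d (conj dA ad).
  exists (t / s); last by rewrite gE scalerA divfK // dE.
  (* The face is so far contained in a line; an inequality strict at the generator shows that the
     coefficient is non-negative. *)
  have [b bA bg] := gen_pos AG gG.
  have : 0 <= pairing b ((t / s) *: G`_i).
    by rewrite gE scalerA divfK // -dE dA.2.
  by rewrite linearZ /= pmulr_lge0.
split; last exact/ray_has_dim1/gen_neq0.
have gA := gen_in AG gG.
(* The sum of all inequalities tight at [g] exposes the smallest face containing [g]. *)
pose a := \sum_(b <- A | pairing b g == 0) b.
have aE d : pairing a d = \sum_(b <- A | pairing b g == 0) pairing b d.
  by rewrite pairingC linear_sum /=; apply: eq_bigr => b _; rewrite pairingC.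
exists a; split.
  by move=> d [_ dA]; rewrite aE big_seq_cond sumr_ge0 // => b /andP[/dA].
apply/seteqP; split=> [_ [t /= t0 <-]|d [dA]].
  split.
    split=> [k|b bA]; first by rewrite mxE gA.1 mulr0.
    by rewrite linearZ /= mulr_ge0 // gA.2.
  by rewrite linearZ /= aE big1 ?mulr0 // => b /eqP.
rewrite aE big_seq_cond => /eqP; rewrite psumr_eq0; last first.
  by move=> b /andP[/dA.2].
move/allP => Hd; have gd : carries A g d.
  by move=> b bA bg; apply/eqP/(implyP (Hd b bA)); rewrite bA bg /=.
have [c [c0 dE]] := decomp dA.
(* Any generator used in [d] satisfies with equality everything tight at [g], so by maximality it is
   [g]. *)
have all_g i : c i != 0 -> G`_i = g.
  move=> ci; apply: Gmax; rewrite ?mem_nth // => b bA bg.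
  have := decomp_carries c0 ci bA; rewrite -dE; apply; exact: gd.
exists (\sum_i c i); first by rewrite /= sumr_ge0.
rewrite dE scaler_suml; apply: eq_bigr => i _.
by have [->|/all_g ->//] := eqVneq (c i) 0; rewrite !scale0r.
Qed.

End Generated.

(** * Flags, dimensions of faces, and facets *)

Fixpoint flag (l : seq (V * V)) : Prop :=
  if l is (g, b) :: l' then
    [/\ pairing b g != 0, (forall q, q \in l' -> pairing b q.1 = 0) & flag l']
  else True.

Lemma pairing_span X b y :
  (forall x, x \in X -> pairing b x = 0) -> y \in <<X>>%VS -> pairing b y = 0.
Proof.
move=> bX /(@coord_span _ _ _ (in_tuple X)) ->; rewrite linear_sum /= big1 // => i _.
by rewrite linearZ /= bX ?mulr0 // mem_nth.
Qed.

(** The matrix of pairings is triangular with nonzero diagonal: the form attached to the head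
    vanishes on the span of the tail but not at the head. *)
Lemma flag_free l : flag l -> free (map fst l).
Proof.
elim: l => [|[g b] l IH] /=; first by rewrite nil_free.
move=> [bg bl /IH fl]; rewrite free_cons fl andbT.
apply: contraNN bg => /pairing_span -> // _ /mapP[q ql ->]; exact: bl.
Qed.

Lemma has_dim_span (S : set V) X Y :
  (forall x, x \in X -> S x) -> (forall x, S x -> x \in <<Y>>%VS) ->
  (<<X>> <= <<Y>>)%VS.
Proof. by move=> XS SY; apply/span_subvP => x /XS/SY. Qed.

Lemma has_dim_uniq (S : set V) k l : has_dim S k -> has_dim S l -> k = l.
Proof.
move=> [X [XS /eqP fX <- SX]] [Y [YS /eqP fY <- SY]].
by apply/eqP; rewrite -fX -fY eqn_leq !dimvS // (has_dim_span (S := S)).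
Qed.

Section Flags.
Variables (A E : seq V) (k : nat).
Hypotheses (sE : size E = k.+1)
           (EZ : forall x, zero_diag x -> x \in <<E>>%VS).

(** [E] bounds the dimension of the zero-diagonal space by [k.+1], so that many independent vectors
    already span it. *)
Lemma span_full X x : (forall x, x \in X -> zero_diag x) -> free X ->
  size X = k.+1 -> zero_diag x -> x \in <<X>>%VS.
Proof.
move=> X0 /eqP fX sX /EZ; suff -> : <<X>>%VS = <<E>>%VS by [].
apply/eqP; rewrite eqEdim (has_dim_span (S := @zero_diag R n)) //= fX sX -sE.
exact: dim_span.
Qed.

Variables (a g : V) (l : seq (V * V)).
Hypotheses (lflag : flag ((g, a) :: l)) (sl : size l = k)
           (gA : hcone A g) (lA : forall q, q \in l -> hcone A q.1).

Let XA x : x \in g :: map fst l -> hcone A x.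
Proof. by rewrite inE => /predU1P[->//|/mapP[q ql ->]]; exact: lA. Qed.

Lemma flag_has_dim_hcone : has_dim (hcone A) k.+1.
Proof.
exists (g :: map fst l); split=> //.
- exact: (flag_free lflag).
- by rewrite /= size_map sl.
- move=> x [x0 _]; apply: span_full => //; first by move=> y /XA[].
    exact: (flag_free lflag).
  by rewrite /= size_map sl.
Qed.

(** The tail of the flag lies in the face. A point of the face is a multiple of [g] plus a
    combination of the tail, and evaluating [a] kills the multiple of [g]. *)
Lemma flag_has_dim_induced : has_dim (induced (hcone A) a) k.
Proof.
have /= [ag al fl] := lflag.
have lX x : x \in map fst l -> pairing a x = 0.
  by case/mapP=> q ql ->; exact: al.
exists (map fst l); split=> //.
- by move=> x xl; split; [apply: XA; rewrite inE xl orbT | exact: lX].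
- exact: flag_free.
- by rewrite size_map.
- move=> x [xA ax]; have : x \in <<g :: map fst l>>%VS.
    apply: span_full; [by move=> y /XA[]|exact: (flag_free lflag)| |by case: xA].
    by rewrite /= size_map sl.
  rewrite span_cons => /memv_addP[_ /vlineP[t ->] [y yl xE]].
  move: ax; rewrite xE linearD linearZ /= (pairing_span lX yl) addr0 => /eqP.
  by rewrite mulf_eq0 (negbTE ag) orbF => /eqP->; rewrite scale0r add0r.
Qed.

End Flags.

(** Finitely many strict inequalities at [x] leave room to move a positive distance in the direction
    of [- y]. *)
Lemma interior_slack A x y : (forall a, a \in A -> 0 < pairing a x) ->
  exists2 e : R, 0 < e & forall a, a \in A -> e * pairing a y <= pairing a x.
Proof.
elim: A => [|b A IH] xA; first by exists 1.
have [|e e0 eA] := IH; first by move=> a aA; rewrite xA // inE aA orbT.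
have bx := xA b (mem_head _ _).
(* The summand 1 keeps the denominator positive even when [b] vanishes at [y]. *)
have d0 : 0 < 1 + `|pairing b y| by rewrite ltr_pwDl.
pose e' := Num.min e (pairing b x / (1 + `|pairing b y|)).
have e'0 : 0 < e' by rewrite lt_min e0 divr_gt0.
exists e' => // a; rewrite inE => /predU1P[->|aA].
  apply: le_trans (_ : e' * (1 + `|pairing b y|) <= _).
    by rewrite ler_pM2l // (le_trans (ler_norm _)) // lerDr.
  by rewrite -ler_pdivlMr // ge_min lexx orbT.
have [ay|ay] := leP (pairing a y) 0.
  by rewrite (le_trans _ (ltW (xA a _))) ?mulr_ge0_le0 ?(ltW e'0) // inE aA orbT.
by apply: le_trans (eA a aA); rewrite ler_pM2r // ge_min lexx.
Qed.

Lemma facets_hcone A k : has_dim (hcone A) k.+1 ->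
  (forall a, a \in A -> has_dim (induced (hcone A) a) k) ->
  facets (hcone A) = [set induced (hcone A) a | a in [set` A]].
Proof.
move=> dC dF; apply/seteqP; split=> [F [[a [aV FE]] [k']]|_ [a /= aA <-]]; last first.
  split; last by exists k; split=> //; exact: dF.
  by exists a; split=> // d [_ dA]; exact: dA.
rewrite FE => -[/has_dim_uniq/(_ dC)[->] [X [XF /eqP fX sX FX]]].
(* The sum of a basis of the face behaves like a relative interior point: an inequality tight at [x]
   is tight on the whole basis. *)
pose x := \sum_(z <- X) z.
have xA : hcone A x.
  split=> [i|b bA].
    by rewrite summxE big_seq big1 // => z /XF[[z0 _] _]; exact: z0.
  by rewrite linear_sum big_seq sumr_ge0 // => z /XF[[_ zA] _]; exact: zA.
have ax : pairing a x = 0.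
  by rewrite linear_sum big_seq big1 // => z /XF[].
have [b bA bx] : exists2 b, b \in A & pairing b x = 0.
  apply: contrapT => no.
  have pos b : b \in A -> 0 < pairing b x.
    move=> bA; rewrite lt_def xA.2 // andbT; apply/eqP => bx.
    by apply: no; exists b.
  (* If [x] were strict for every inequality, the face would be the whole cone, which has the wrong
     dimension. *)
  suff CF : induced (hcone A) a = hcone A.
    have : has_dim (hcone A) k by rewrite -{1}CF; exists X; split=> //; exact/eqP.
    by move/has_dim_uniq/(_ dC)/n_Sn.
  apply/seteqP; split=> [d []//|y yA]; split=> //.
  have [e e0 eA] := interior_slack y pos.
  (* [a] vanishes at [x] and is non-negative here, hence is non-positive at [y]. *)
  have : hcone A (x + (- e) *: y).
    by apply: hcone_lin => [//||b bA]; [case: yA | rewrite opprK eA].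
  move/aV; rewrite linearD linearZ /= ax add0r mulNr oppr_ge0 pmulr_rle0 // => ay.
  by apply/le_anti; rewrite ay aV.
have bX z : z \in X -> pairing b z = 0.
  move: bx; rewrite linear_sum big_seq => /eqP; rewrite psumr_eq0; last first.
    by move=> w /XF[[_ wA] _]; exact: wA.
  by move=> /allP H zX; apply/eqP/(implyP (H z zX)).
exists b => //.
have Fb : induced (hcone A) a `<=` induced (hcone A) b.
  by move=> d dF'; split; [case: dF' | exact: pairing_span bX (FX d dF')].
have [Y [YF /eqP fY sY FY]] := dF b bA.
(* One face contains the other and both have dimension [k], so their spans agree, and with them the
   faces. *)
have XY : <<X>>%VS = <<Y>>%VS.
  apply/eqP; rewrite eqEdim fX fY sX sY leqnn andbT.
  by apply: has_dim_span FY => z /XF/Fb.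
apply/seteqP; split=> // d dFb; split; first by case: dFb.
apply: (@pairing_span X); first by move=> z /XF[].
by rewrite XY; exact: FY.
Qed.

(** * The action of reversal and permutations, and its orbits *)

Section Symmetry.
Implicit Types s t : bool * 'S_n.

(** A product of permutations applies its left factor first, so relabelling the indices composes in
    the same order as the group law. *)
Lemma sym_actM s t d :
  sym_act s (sym_act t d) = sym_act (s.1 (+) t.1, s.2 * t.2)%g d :> V.
Proof.
by apply/matrixP => i j; rewrite !mxE !permM; case: s.1; case: t.1.
Qed.

Lemma sym_act1 d : sym_act (false, 1%g) d = d :> V.
Proof. by apply/matrixP => i j; rewrite !mxE /= !perm1. Qed.

Definition sym_inv s : bool * 'S_n := (s.1, s.2^-1)%g.

Lemma sym_actK s : cancel (@sym_act R n s) (sym_act (sym_inv s)).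
Proof.
by move=> d; rewrite sym_actM /= addbb mulVg sym_act1.
Qed.

Lemma sym_actKV s : cancel (@sym_act R n (sym_inv s)) (sym_act s).
Proof.
by move=> d; rewrite sym_actM /= addbb mulgV sym_act1.
Qed.

(** A permutation reindexes both sums, and reversal exchanges them. *)
Lemma pairing_sym s a d : pairing (sym_act s a) (sym_act s d) = pairing a d.
Proof.
rewrite /pairing; transitivity
   (\sum_i \sum_(j | j != i) (if s.1 then a j i * d j i else a i j * d i j)).
  rewrite [RHS](reindex_inj (@perm_inj _ s.2)) /=; apply: eq_bigr => i _.
  rewrite [RHS](reindex_inj (@perm_inj _ s.2)) /=; apply: eq_big => [j|j _].
    by rewrite (inj_eq perm_inj).
  by rewrite !mxE; case: s.1.
case: s.1 => //; rewrite (exchange_big_dep xpredT) //=; apply: eq_bigr => i _.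
by apply: eq_bigl => j; rewrite eq_sym.
Qed.

Lemma sym_actZ s (t : R) d : sym_act s (t *: d) = t *: sym_act s d.
Proof. by apply/matrixP => i j; rewrite !mxE; case: s.1. Qed.

Lemma sym_act_ray s g : sym_act s @` ray g = ray (sym_act s g).
Proof.
apply/seteqP; split=> [_ [_ [t t0 <-] <-]|_ [t t0 <-]].
  by exists t => //; rewrite sym_actZ.
by exists (t *: g); [exists t | rewrite sym_actZ].
Qed.

Lemma sym_act_induced A s a :
  (forall t b, b \in A -> sym_act t b \in A) ->
  sym_act s @` induced (hcone A) a = induced (hcone A) (sym_act s a).
Proof.
move=> Aclosed.
have hc t d : hcone A d -> hcone A (sym_act t d).
  move=> [d0 dA]; split=> [i|b bA]; first by rewrite mxE !d0; case: ifP.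
  by rewrite -(pairing_sym (sym_inv t)) sym_actK dA // Aclosed.
apply/seteqP; split=> [_ [d [dA ad] <-]|d [dA ad]].
  by split; [exact: hc | rewrite pairing_sym].
exists (sym_act (sym_inv s) d); last exact: sym_actKV.
by split; [exact: hc | rewrite -(pairing_sym s) sym_actKV].
Qed.

Lemma orbit_set_refl (F : set V) : orbit_set F F.
Proof.
exists (false, 1%g) => //; apply/seteqP; split=> [_ [d Fd <-]|d Fd].
  by rewrite sym_act1.
by exists d => //; rewrite sym_act1.
Qed.

Lemma sub_orbit_set (F F' : set V) : orbit_set F F' -> orbit_set F' `<=` orbit_set F.
Proof.
move=> [s _ <-] _ [t _ <-]; exists (t.1 (+) s.1, t.2 * s.2)%g => //.
apply/seteqP; split=> [_ [d Fd <-]|_ [_ [d Fd <-] <-]].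
  by exists (sym_act s d); [exists d | rewrite sym_actM].
by exists d => //; rewrite sym_actM.
Qed.

Lemma orbit_set_sym (F F' : set V) : orbit_set F F' -> orbit_set F' F.
Proof.
move=> [s _ <-]; exists (sym_inv s) => //.
apply/seteqP; split=> [_ [_ [d Fd <-] <-]|d Fd]; first by rewrite sym_actK.
by exists (sym_act s d); [exists d | rewrite sym_actK].
Qed.

Lemma orbit_set_eq (F F' : set V) : orbit_set F F' -> orbit_set F' = orbit_set F.
Proof.
move=> FF'; apply/seteqP; split; apply: sub_orbit_set => //.
exact: orbit_set_sym.
Qed.

End Symmetry.

End Polyhedral.

(** The image under [f] and the initial segment of the naturals are both injective images of [s],
    the latter under [index]. *)
Lemma card_image_seq (T : eqType) (U : Type) (f : T -> U) (s : seq T) :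
  uniq s -> {in s &, injective f} -> (f @` [set` s] #= `I_(size s))%card.
Proof.
move=> us fi.
have card_s (U' : Type) (h : T -> U') : {in s &, injective h} -> (h @` [set` s] #= [set` s])%card.
  by move=> hi; apply: inj_card_eq => x y; rewrite !inE; exact: hi.
rewrite (card_eql (card_s _ f fi)) card_eq_sym.
have <- : index^~ s @` [set` s] = `I_(size s).
  apply/seteqP; split=> [_ [x /= xs <-]|i /= ilt]; first by rewrite index_mem.
  have [x0 _] : exists x0 : T, true by case: (s) ilt => // x; exists x.
  by exists (nth x0 s i); rewrite ?mem_nth ?index_uniq.
by apply: card_s => x y xs ys E; rewrite -(nth_index x xs) E nth_index.
Qed.

(** * Counting orbits through finite codes *)

Section Orbits.
Variables (R : realFieldType) (n : nat) (T : eqType).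
Local Notation V := 'M[R]_n.
Variables (f : T -> set V) (orb : T -> seq T) (L reps : seq T).
Hypotheses (finj : {in L &, injective f})
  (orbE : forall c, c \in L -> orbit_set (f c) = f @` [set` orb c])
  (repsL : {subset reps <= L}) (orbL : forall r, r \in reps -> {subset orb r <= L})
  (Lorb : forall c, c \in L -> exists2 r, r \in reps & c \in orb r)
  (ureps : uniq reps)
  (sep : forall r r', r \in reps -> r' \in reps -> r' \in orb r -> r' = r).

Lemma orbits_image :
  orbits (f @` [set` L]) = [set orbit_set (f r) | r in [set` reps]].
Proof.
apply/seteqP; split=> [_ [_ [c /= cL <-] <-]|_ [r /= rr <-]]; last first.
  by exists (f r) => //; exists r => //; exact: repsL.
have [r rr cr] := Lorb cL; exists r => //; apply/esym/orbit_set_eq.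
by rewrite orbE ?repsL //; exists c.
Qed.

(** If two representatives have the same orbit, injectivity of [f] on [L] turns this into membership
    in a coded orbit, which [sep] excludes for distinct ones. *)
Lemma card_orbits : (orbits (f @` [set` L]) #= `I_(size reps))%card.
Proof.
rewrite orbits_image; apply: card_image_seq => // r r' rr rr' E.
have : orbit_set (f r') (f r) by rewrite -E; exact: orbit_set_refl.
rewrite orbE ?repsL // => -[c cr /finj E']; apply: sep => //.
by rewrite -E' ?(orbL rr' cr) ?repsL.
Qed.

End Orbits.

Local Open Scope nat_scope.

(** * Coordinate vectors and incidence masks *)

Notation vec := (seq nat).
(** The coefficient vector is the difference of the two components, which keeps all computation in
    [nat]. A [gen] is a vector with the mask of the inequalities tight at it. *)
Notation ineq := (seq nat * seq nat)%type.
Notation gen := (seq nat * seq bool)%type.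

Fixpoint dot (s t : vec) : nat :=
  match s, t with
  | x :: s', y :: t' => x * y + dot s' t'
  | _, _ => 0
  end.

Definition tight (a : ineq) (g : vec) : bool := dot a.1 g == dot a.2 g.
Definition holds (a : ineq) (g : vec) : bool := dot a.2 g <= dot a.1 g.
Definition excess (a : ineq) (g : vec) := dot a.1 g - dot a.2 g.
Definition deficit (a : ineq) (g : vec) := dot a.2 g - dot a.1 g.

Fixpoint vadd (s t : vec) : vec :=
  match s, t with
  | x :: s', y :: t' => (x + y) :: vadd s' t'
  | _, _ => [::]
  end.

Definition vscale k : vec -> vec := map (muln k).

Lemma dotD p s t : size s = size t -> dot p (vadd s t) = dot p s + dot p t.
Proof.
elim: p s t => [|x p IH] [|y s] [|z t] //= [/IH ->].
by rewrite mulnDr addnACA.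
Qed.

Lemma dotZ p k s : dot p (vscale k s) = k * dot p s.
Proof.
elim: p s => [|x p IH] [|y s] //=; rewrite ?muln0 //.
by rewrite IH mulnDr mulnCA.
Qed.

Lemma size_vadd s t : size s = size t -> size (vadd s t) = size s.
Proof. by elim: s t => [|x s IH] [|y t] //= [/IH ->]. Qed.

Lemma dotE m p s : size p <= m ->
  dot p s = \sum_(k < m) nth 0 p k * nth 0 s k.
Proof.
elim: p m s => [|x p IH] m s pm; first by rewrite big1 // => k _; rewrite nth_nil.
case: m pm => // m pm; case: s => [|y s] /=.
  by rewrite big1 // => k _; rewrite nth_nil muln0.
by rewrite big_ord_recl /= (IH m).
Qed.

(** Division by the gcd of the entries. Testing that scaling back returns [s] replaces a
    divisibility proof. *)
Definition reduce (s : vec) : vec :=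
  let d := foldr gcdn 0 s in
  let t := map (divn^~ d) s in
  if (0 < d) && (vscale d t == s) then t else s.

Lemma reduceP s : exists2 d, 0 < d & vscale d (reduce s) = s.
Proof.
rewrite /reduce; case: ifP => [/andP[d0 /eqP dE]|_]; first by exists (foldr gcdn 0 s).
by exists 1 => //; rewrite /vscale (eq_map mul1n) map_id.
Qed.

Fixpoint meet_mask (m1 m2 : seq bool) : seq bool :=
  match m1, m2 with
  | b1 :: m1', b2 :: m2' => (b1 && b2) :: meet_mask m1' m2'
  | _, _ => [::]
  end.

Fixpoint sub_mask (m1 m2 : seq bool) : bool :=
  match m1, m2 with
  | b1 :: m1', b2 :: m2' => if b1 && ~~ b2 then false else sub_mask m1' m2'
  | [::], _ => true
  | _ :: _, [::] => false
  end.

Lemma sub_mask_refl m : sub_mask m m.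
Proof. by elim: m => //= b m ->; rewrite andbN. Qed.

Lemma sub_mask_trans m1 m2 m3 : sub_mask m1 m2 -> sub_mask m2 m3 -> sub_mask m1 m3.
Proof.
elim: m1 m2 m3 => [|b1 m1 IH] [|b2 m2] [|b3 m3] //=.
by case: b1 b2 b3 => [] [] [] //=; exact: IH.
Qed.

Lemma sub_mask_map (T : eqType) (p q : pred T) s :
  sub_mask (map p s) (map q s) -> {in s, forall x, p x -> q x}.
Proof.
elim: s => //= x s IH; case: ifP => // pq /IH H y.
by rewrite inE => /predU1P[->|/H//]; case: (p x) (q x) pq => [] [].
Qed.

Lemma meet_mask_map (T : eqType) (p q : pred T) s :
  meet_mask (map p s) (map q s) = map (predI p q) s.
Proof. by elim: s => //= x s ->. Qed.

(** * The double description method *)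

(** The positive combination of [g] and [h], on opposite sides of [a], that lies on the hyperplane
    of [a]. *)
Definition combine (a : ineq) (g h : vec) : vec :=
  reduce (vadd (vscale (deficit a h) g) (vscale (excess a g) h)).

(** The mask of the combination is known in advance: [a], and whatever is tight at both parents. A
    candidate below a kept mask is dropped; otherwise it evicts the elements below its own. *)
Definition insert (a : ineq) (acc : seq gen) (q : gen * gen) : seq gen :=
  let m := true :: meet_mask q.1.2 q.2.2 in
  if has (fun r : gen => sub_mask m r.2) acc then acc else
  (combine a q.1.1 q.2.1, m) :: filter (fun r : gen => ~~ sub_mask r.2 m) acc.

Definition dd_step (a : ineq) (L : seq gen) : seq gen :=
  let P := [seq r <- L | 0 < excess a r.1] in
  let N := [seq r <- L | 0 < deficit a r.1] in
  let Z := [seq (r.1, true :: r.2) | r : gen <- L & tight a r.1] in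
  [seq (r.1, false :: r.2) | r : gen <- P]
  ++ foldl (insert a) Z [seq (g, h) | g <- P, h <- N].

(** Inequalities are added from the last to the first, so the masks of [dd L B] follow the order of
    [B ++ A] when those of [L] follow [A]. *)
Definition dd := foldr dd_step.

Lemma insert_mem a acc q r : r \in insert a acc q ->
  r \in acc \/ r = (combine a q.1.1 q.2.1, true :: meet_mask q.1.2 q.2.2).
Proof.
rewrite /insert; case: ifP => _; first by left.
rewrite inE => /predU1P[->|]; first by right.
by rewrite mem_filter => /andP[_]; left.
Qed.

(** Up to inclusion of masks nothing is lost: an evicted element lies below the candidate. *)
Lemma insert_keep a acc q r : r \in acc ->
  exists2 r', r' \in insert a acc q & sub_mask r.2 r'.2.
Proof.
rewrite /insert => racc; case: ifP => _; first by exists r => //; exact: sub_mask_refl.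
set m := true :: _; case: (boolP (sub_mask r.2 m)) => rm.
  by eexists; first exact: mem_head.
by exists r; [rewrite inE mem_filter rm racc orbT | exact: sub_mask_refl].
Qed.

Lemma insert_new a acc q : exists2 r', r' \in insert a acc q &
  sub_mask (true :: meet_mask q.1.2 q.2.2) r'.2.
Proof.
rewrite /insert; case: ifP => [/hasP[r racc rm]|_]; first by exists r.
by eexists; [exact: mem_head | exact: sub_mask_refl].
Qed.

Lemma foldl_insert_mem a acc qs r : r \in foldl (insert a) acc qs ->
  r \in acc \/ exists2 q, q \in qs &
    r = (combine a q.1.1 q.2.1, true :: meet_mask q.1.2 q.2.2).
Proof.
elim: qs acc => [|q qs IH] acc /=; first by left.
case/IH => [/insert_mem[|->]|[q' q'qs ->]]; first by left.
  by right; exists q; rewrite ?mem_head.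
by right; exists q'; rewrite // inE q'qs orbT.
Qed.

Lemma foldl_insert_keep a acc qs r : r \in acc ->
  exists2 r', r' \in foldl (insert a) acc qs & sub_mask r.2 r'.2.
Proof.
elim: qs acc r => [|q qs IH] acc r racc /=; first by exists r => //; exact: sub_mask_refl.
have [r1 /IH[r2 r2in s12] s1] := insert_keep a q racc.
by exists r2 => //; exact: sub_mask_trans s1 s12.
Qed.

Lemma foldl_insert_new a acc qs q : q \in qs ->
  exists2 r', r' \in foldl (insert a) acc qs &
    sub_mask (true :: meet_mask q.1.2 q.2.2) r'.2.
Proof.
elim: qs acc => // q' qs IH acc; rewrite inE => /predU1P[->|qin]; last exact: IH.
have [r1 /(foldl_insert_keep a qs)[r2 r2in s12] s1] := insert_new a acc q'.
by exists r2 => //; exact: sub_mask_trans s1 s12.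
Qed.

(** The invariant of the method; its last conjunct, an inequality that is not tight, becomes
    [gen_pos]. *)
Definition good_gen (A : seq ineq) (r : gen) : bool :=
  [&& size r.1 == 12, r.2 == [seq tight a r.1 | a <- A],
      all (holds^~ r.1) A & has negb r.2].

Lemma addn_eq_le x x' y y' :
  x' <= x -> y' <= y -> x + y = x' + y' -> x = x' /\ y = y'.
Proof. by lia. Qed.

(** This is the tightness of [combine] on the new inequality, with truncated subtractions as
    weights. *)
Lemma subn_balance n p n' p' : n <= p -> p' <= n' ->
  (n' - p') * p + (p - n) * p' = (n' - p') * n + (p - n) * n'.
Proof.
move=> /subnKC <- /subnKC <-; move: (p - n) (n' - p') => e f.
by rewrite !addKn !mulnDr (mulnC e f); lia.
Qed.

Lemma good_combine A a (r s : gen) : good_gen A r -> good_gen A s ->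
  0 < excess a r.1 -> 0 < deficit a s.1 ->
  good_gen (a :: A) (combine a r.1 s.1, true :: meet_mask r.2 s.2).
Proof.
case: r s => [g m] [h k] /= /and4P[/= /eqP sg /eqP mE gA mn] /and4P[/= /eqP sh /eqP kE hA kn].
set u := deficit a h; set v := excess a g => v0 u0.
have [d d0 dE] := reduceP (vadd (vscale u g) (vscale v h)).
rewrite -/(combine a g h) in dE; set c := combine a g h in dE *.
have ugvh : size (vscale u g) = size (vscale v h) by rewrite !size_map sg sh.
have sc : size c = 12.
  by move/(congr1 size): dE; rewrite size_map size_vadd // size_map sg.
have dotc p : d * dot p c = u * dot p g + v * dot p h.
  by rewrite -dotZ dE dotD // !dotZ.
have eqc b : tight b c = (u * dot b.1 g + v * dot b.1 h == u * dot b.2 g + v * dot b.2 h).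
  by rewrite -!dotc eqn_pmul2l.
have lec b : holds b c = (u * dot b.2 g + v * dot b.2 h <= u * dot b.1 g + v * dot b.1 h).
  by rewrite -!dotc leq_pmul2l.
(* Both weights are positive, so equality holds at the combination exactly when it holds at both
   parents. *)
have tb b : b \in A -> holds b c /\ tight b c = tight b g && tight b h.
  move=> bA; have := allP gA b bA; have := allP hA b bA.
  rewrite lec eqc /holds /tight => le1 le2.
  split; first by rewrite leq_add // leq_mul2l ?le1 ?le2 orbT.
  apply/eqP/andP => [E|[/eqP-> /eqP->]//].
  have : u * dot b.2 g <= u * dot b.1 g by rewrite leq_mul2l le2 orbT.
  have : v * dot b.2 h <= v * dot b.1 h by rewrite leq_mul2l le1 orbT.
  move=> l1 l2; have [/eqP E1 /eqP E2] := addn_eq_le l2 l1 E.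
  by move: E1 E2; rewrite !eqn_pmul2l.
have ta : tight a c.
  move: v0 u0; rewrite eqc /u /v /deficit /excess !subn_gt0 => lt1 lt2.
  by apply/eqP; apply: subn_balance; exact: ltnW.
rewrite /good_gen /= sc eqxx ta /=; apply/and3P; split.
- apply/eqP; congr cons; rewrite mE kE meet_mask_map.
  by apply/eq_in_map => b /tb[_ ->].
- by rewrite /holds (eqP ta) leqnn /=; apply/allP => b /tb[].
- move: mn; rewrite mE kE meet_mask_map => /hasP[_ /mapP[b bA ->] nb].
  apply/hasP; exists (tight b g && tight b h); last by rewrite (negbTE nb).
  by apply/mapP; exists b.
Qed.

Lemma good_dd_step A a L : {in L, forall r, good_gen A r} ->
  {in dd_step a L, forall r, good_gen (a :: A) r}.
Proof.
move=> LA r; rewrite mem_cat => /orP[/mapP[s]|/foldl_insert_mem[/mapP[s]|[[s t]]]].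
- rewrite mem_filter subn_gt0 => /andP[lt /LA/and4P[ss /eqP sm sA _] ->].
  by rewrite /good_gen /= ss sA sm /holds (ltnW lt) /tight (gtn_eqF lt) /= eqxx.
- rewrite mem_filter => /andP[s0 /LA/and4P[ss /eqP sm sA sn] ->].
  by rewrite /good_gen /= ss sA sn sm s0 /= /holds (eqP s0) leqnn eqxx.
- case/allpairsP => -[s' t'] /= []; rewrite !mem_filter => /andP[s0 /LA gs] /andP[t0 /LA gt].
  by case=> -> -> ->; exact: good_combine.
Qed.

(** * From coordinates to matrices *)

Definition entry (s : vec) (i j : nat) : nat :=
  if i == j then 0 else nth 0 s (3 * i + unbump i j).

Definition off_diag : seq (nat * nat) :=
  [seq (i, j) | i <- iota 0 4, j <- filter (predC1 i) (iota 0 4)].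

Definition tab (f : nat -> nat -> nat) : vec := [seq f q.1 q.2 | q <- off_diag].

Lemma entry_tab f (i j : 'I_4) : entry (tab f) i j = if i == j then 0 else f i j.
Proof.
rewrite /entry -val_eqE.
by move: i j => [[|[|[|[|i]]]] Hi] [[|[|[|[|j]]]] Hj].
Qed.

Definition vsum (qs : seq (nat * nat)) : vec :=
  tab (fun i j => count_mem (i, j) qs).

Section Coords.
Variable R : realFieldType.
Local Notation V := 'M[R]_4.
Local Notation mx := (mx_of_coords R).

Lemma mx_entry s i j : mx s i j = (entry s i j)%:R%R.
Proof. by rewrite mxE /entry val_eqE; case: ifP. Qed.

Lemma mx_zero_diag s : zero_diag (mx s).
Proof. by move=> i; rewrite mxE eqxx. Qed.

Lemma pairing_mx p s : size p <= 12 -> pairing (mx p) (mx s) = (dot p s)%:R%R.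
Proof.
move=> sp; rewrite (dotE s sp) /pairing.
under eq_bigr do rewrite big_mkcond.
rewrite !big_ord_recl !big_ord0 /= !mxE /= !natrD !natrM !addr0 !add0r !addrA.
reflexivity.
Qed.

Definition ineq_mx (a : ineq) : V := (mx a.1 - mx a.2)%R.

Definition small (a : ineq) := (size a.1 <= 12) && (size a.2 <= 12).

Lemma pairing_ineq_mx a s : small a ->
  pairing (ineq_mx a) (mx s) = ((dot a.1 s)%:R - (dot a.2 s)%:R)%R.
Proof.
by case/andP=> s1 s2; rewrite pairingC linearB /= !(pairingC (mx s)) !pairing_mx.
Qed.

Lemma tightE a s : small a -> (pairing (ineq_mx a) (mx s) == 0%R) = tight a s.
Proof. by move=> sa; rewrite pairing_ineq_mx // subr_eq0 eqr_nat. Qed.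

Lemma holdsE a s : small a -> (0%R <= pairing (ineq_mx a) (mx s))%R = holds a s.
Proof. by move=> sa; rewrite pairing_ineq_mx // subr_ge0 ler_nat. Qed.

Lemma excessE a s : small a -> (0%R < pairing (ineq_mx a) (mx s))%R = (0 < excess a s).
Proof. by move=> sa; rewrite pairing_ineq_mx // subr_gt0 ltr_nat subn_gt0. Qed.

Lemma deficitE a s : small a -> (pairing (ineq_mx a) (mx s) < 0)%R = (0 < deficit a s).
Proof. by move=> sa; rewrite pairing_ineq_mx // subr_lt0 ltr_nat subn_gt0. Qed.

Definition mxs (L : seq gen) : seq V := [seq mx r.1 | r <- L].

Lemma carries_mask A g h : all small A ->
  sub_mask [seq tight a g | a <- A] [seq tight a h | a <- A] ->
  carries (map ineq_mx A) (mx g) (mx h).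
Proof.
move=> sA /sub_mask_map gh _ /mapP[a aA ->] /eqP.
have sa := allP sA a aA.
by rewrite tightE // => /gh => /(_ aA); rewrite -tightE // => /eqP.
Qed.

Lemma generates_good A L : all small A -> {in L, forall r, good_gen A r} ->
  meets_faces (map ineq_mx A) (mxs L) -> generates (map ineq_mx A) (mxs L).
Proof.
move=> sA LA mf; split=> // _ /mapP[r rL ->].
  have /and4P[_ _ /allP rA _] := LA r rL; split; first exact: mx_zero_diag.
  by move=> _ /mapP[a aA ->]; rewrite holdsE ?rA // (allP sA).
have /and4P[_ /eqP rE /allP rA] := LA r rL.
rewrite rE => /hasP[_ /mapP[a aA ->] na].
exists (ineq_mx a); first exact: map_f.
by rewrite lt_def tightE ?holdsE ?(allP sA) // na rA.
Qed.

Lemma generates_dd_step A a L : all small (a :: A) ->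
  {in L, forall r, good_gen A r} -> generates (map ineq_mx A) (mxs L) ->
  generates (map ineq_mx (a :: A)) (mxs (dd_step a L)).
Proof.
move=> /[dup] saA /andP[sa sA] LA gL.
have LaA := good_dd_step (a := a) LA.
have maskE r : r \in dd_step a L -> r.2 = [seq tight b r.1 | b <- a :: A].
  by move/LaA/and4P => [_ /eqP].
apply: generates_good => //; apply: (meets_faces_cons gL).
  move=> _ /mapP[r rL ->]; rewrite le0r tightE // excessE // => ra.
  (* A generator on the hyperplane starts in the accumulator and stays dominated; a strictly
     positive one is kept as it is. *)
  have [r' r'D rr'] : exists2 r', r' \in dd_step a L &
      sub_mask [seq tight b r.1 | b <- a :: A] r'.2.
    have /and4P[_ /eqP rm _ _] := LA r rL; case/orP: ra => ra.
      have [|r' r'D rr'] := @foldl_insert_keep a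
         [seq (r.1, true :: r.2) | r : gen <- L & tight a r.1]
         [seq (g, h) | g <- [seq r <- L | 0 < excess a r.1],
                       h <- [seq r <- L | 0 < deficit a r.1]] (r.1, true :: r.2).
        by apply/mapP; exists r; rewrite // mem_filter ra.
      exists r'; first by rewrite mem_cat r'D orbT.
      by rewrite /= ra -rm.
    exists (r.1, false :: r.2).
      by rewrite mem_cat map_f // mem_filter ra.
    rewrite /= -rm sub_mask_refl; move: ra; rewrite /tight subn_gt0 => /gtn_eqF->.
    by [].
  exists (mx r'.1); first exact: (map_f (fun r : gen => mx r.1)).
  by apply: (@carries_mask (a :: A)) => //; rewrite -(maskE r').
move=> _ _ /mapP[r rL ->] /mapP[s sL ->]; rewrite excessE // deficitE // => ra sa'.
have /and4P[_ /eqP rm _ _] := LA r rL; have /and4P[_ /eqP sm _ _] := LA s sL.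
have [|r' r'D] := @foldl_insert_new a
   [seq (r.1, true :: r.2) | r : gen <- L & tight a r.1]
   [seq (g, h) | g <- [seq r <- L | 0 < excess a r.1],
                 h <- [seq r <- L | 0 < deficit a r.1]] (r, s).
  by apply/allpairsP; exists (r, s); rewrite !mem_filter ra sa' rL sL.
have r'L : r' \in dd_step a L by rewrite mem_cat r'D orbT.
rewrite /= rm sm meet_mask_map maskE //= => H.
exists (mx r'.1); first exact: (map_f (fun r : gen => mx r.1)).
(* The leading [true] of the pair's mask forces tightness on [a]. *)
have [ta {}H] : tight a r'.1 /\ sub_mask [seq predI (tight^~ r.1) (tight^~ s.1) i | i <- A]
   [seq tight b r'.1 | b <- A] by case: (tight a r'.1) H.
split; first by apply/eqP; rewrite tightE.
move=> _ /mapP[b bA ->] /eqP br /eqP bs; have sb := allP sA b bA.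
move: br bs; rewrite !tightE // => br bs; apply/eqP; rewrite tightE //.
by apply: (sub_mask_map H) => //=; rewrite br bs.
Qed.

Lemma generates_dd A B L : all small (B ++ A) ->
  {in L, forall r, good_gen A r} -> generates (map ineq_mx A) (mxs L) ->
  {in dd L B, forall r, good_gen (B ++ A) r} /\
  generates (map ineq_mx (B ++ A)) (mxs (dd L B)).
Proof.
move=> sBA LA gL; elim: B sBA => //= b B IH /[dup] sBA /andP[_ /IH[H1 H2]].
by split; [exact: good_dd_step | exact: generates_dd_step].
Qed.

End Coords.

(** * Permutations, orbits and the families of inequalities *)

Lemma image_seq_cat (T : eqType) (U : Type) (f : T -> U) (s t : seq T) :
  f @` [set` s ++ t] = f @` [set` s] `|` f @` [set` t].
Proof.
by rewrite -image_setU; congr image; apply/seteqP; split=> x; rewrite /= mem_cat => /orP.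
Qed.

Lemma image_seq_undup (T : eqType) (U : Type) (f : T -> U) (s : seq T) :
  f @` [set` undup s] = f @` [set` s].
Proof. by congr image; apply/seteqP; split=> x; rewrite /= mem_undup. Qed.

(** Permutations are coded by their lists of values, so that orbits can be evaluated by
    [vm_compute]. *)
Definition perms4 := permutations (iota 0 4).

Lemma mem_perms4 (i j k l : 'I_4) :
  uniq [:: i; j; k; l] -> [:: val i; val j; val k; val l] \in perms4.
Proof.
move=> u; rewrite mem_permutations.
have u' : uniq (map val [:: i; j; k; l]) by rewrite map_inj_uniq //; exact: val_inj.
apply: uniq_perm => //.
have sub : {subset map val [:: i; j; k; l] <= iota 0 4}.
  by move=> x /mapP[y _ ->]; rewrite mem_iota ltn_ord.
by have [] := uniq_min_size u' sub isT.
Qed.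

Lemma perms4P p : p \in perms4 -> exists i j k l : 'I_4,
  uniq [:: i; j; k; l] /\ p = [:: val i; val j; val k; val l].
Proof.
rewrite mem_permutations => pp.
have up : uniq p by rewrite (perm_uniq pp).
have lt x : x \in p -> x < 4 by rewrite (perm_mem pp) mem_iota.
move: (perm_size pp) up lt; case: p {pp} => [|i [|j [|k [|l []]]]] // _ up lt.
have lti x : x \in [:: i; j; k; l] -> nat_of_ord (inord x : 'I_4) = x by move/lt/inordK.
have E : [:: i; j; k; l] = map val (map (fun x => inord x : 'I_4) [:: i; j; k; l]).
  by rewrite -map_comp -[LHS]map_id; apply/eq_in_map => x /lti /= ->.
exists (inord i), (inord j), (inord k), (inord l); split; last exact: E.
by rewrite -(map_inj_uniq val_inj) -E.
Qed.

Lemma fresh4 (s : seq 'I_4) : size s < 4 -> exists l, l \notin s.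
Proof.
move=> ss; apply: contrapT => no.
have : size (enum 'I_4) <= size s.
  apply: uniq_leq_size (enum_uniq _) _ => x _; apply: contrapT => /negP xs.
  by apply: no; exists x.
by rewrite size_enum_ord leqNgt ss.
Qed.

Definition o0 : 'I_4 := @Ordinal 4 0 isT.
Definition o1 : 'I_4 := @Ordinal 4 1 isT.
Definition o2 : 'I_4 := @Ordinal 4 2 isT.
Definition o3 : 'I_4 := @Ordinal 4 3 isT.

Lemma ord4P (P : 'I_4 -> Prop) : P o0 -> P o1 -> P o2 -> P o3 -> forall i, P i.
Proof.
move=> P0 P1 P2 P3 [[|[|[|[|i]]]] Hi] //.
- by rewrite (_ : Ordinal Hi = o0) //; exact: val_inj.
- by rewrite (_ : Ordinal Hi = o1) //; exact: val_inj.
- by rewrite (_ : Ordinal Hi = o2) //; exact: val_inj.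
- by rewrite (_ : Ordinal Hi = o3) //; exact: val_inj.
Qed.

Definition perm_code (s : 'S_4) : seq nat :=
  [:: val (s o0); val (s o1); val (s o2); val (s o3)].

Lemma nth_code s (i : 'I_4) : nth 0 (perm_code s) i = s i.
Proof. by elim/ord4P: i. Qed.

Lemma code_perms4 s : perm_code s \in perms4.
Proof.
apply: mem_perms4; rewrite (_ : [:: _; _; _; _] = map s [:: o0; o1; o2; o3]) //.
by rewrite map_inj_uniq //; exact: perm_inj.
Qed.

Lemma perms4_code p : p \in perms4 -> exists s, p = perm_code s.
Proof.
case/perms4P => i [j [k [l [u ->]]]].
pose f (x : 'I_4) := nth i [:: i; j; k; l] x.
have fi : injective f.
  by move=> x y /eqP; rewrite /f nth_uniq //= => /eqP/val_inj.
by exists (perm fi); rewrite /perm_code !permE.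
Qed.

Definition act_vec (h : bool * seq nat) (s : vec) : vec :=
  tab (fun i j => let: (u, v) := (nth 0 h.2 i, nth 0 h.2 j) in
                  if h.1 then entry s v u else entry s u v).

Definition act_ineq h (a : ineq) : ineq := (act_vec h a.1, act_vec h a.2).

Definition syms : seq (bool * seq nat) := [seq (b, p) | b <- [:: false; true], p <- perms4].

Definition orb_vec s := [seq act_vec h s | h <- syms].
Definition orb_ineq a := [seq act_ineq h a | h <- syms].

Lemma symsP h : h \in syms <-> exists s : bool * 'S_4, h = (s.1, perm_code s.2).
Proof.
split=> [/allpairsP[[b p] /= [_ /perms4_code[s ->] ->]]|[[b s] ->]].
  by exists (b, s).
by apply/allpairsP; exists (b, perm_code s); rewrite code_perms4 /=; split=> //; case: b.
Qed.

Definition on4 T (f : nat -> nat -> nat -> nat -> T) (p : seq nat) : T :=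
  f (nth 0 p 0) (nth 0 p 1) (nth 0 p 2) (nth 0 p 3).

(** All families range over four distinct labels. Labellings giving the same coefficients, such as
    an exchange of the two [c] points, give equal codes and are merged. *)
Definition family (f : nat -> nat -> nat -> nat -> ineq) : seq ineq :=
  undup (map (on4 f) perms4).

Definition ot_code i j k (_ : nat) : ineq := (vsum [:: (i, k); (k, j)], vsum [:: (i, j)]).
Definition nn_code i j (_ _ : nat) : ineq := (vsum [:: (i, j)], vsum [::]).
Definition a4_code c1 c2 a b : ineq :=
  (vsum [:: (a, c1); (a, c2); (c1, b); (c2, b); (b, a)],
   vsum [:: (a, b); (c1, c2); (c2, c1)]).
Definition b4_code c1 c2 a b : ineq :=
  (vsum [:: (c1, a); (a, c1); (c1, b); (c2, a); (a, c2); (c2, b)],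
   vsum [:: (a, b); (c1, c2); (c2, c1)]).
Definition b4r_code c1 c2 a b : ineq :=
  (vsum [:: (a, c1); (c1, a); (b, c1); (a, c2); (c2, a); (b, c2)],
   vsum [:: (b, a); (c2, c1); (c1, c2)]).

Definition OTs := family ot_code.
Definition NNs := family nn_code.
Definition A4s := family a4_code.
Definition B4s := undup (family b4_code ++ family b4r_code).

(** * Matching coded inequalities and symmetries with matrices *)

Section Families.
Variable R : realFieldType.
Local Notation V := 'M[R]_4.
Local Notation mx := (mx_of_coords R).
Local Notation ineq_mx := (@ineq_mx R).

Lemma sym_act_mx (s : bool * 'S_4) v :
  sym_act s (mx v) = mx (act_vec (s.1, perm_code s.2) v).
Proof.
apply/matrixP => i j; rewrite mxE !mx_entry entry_tab !nth_code /=.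
have [->|_] := eqVneq i j; last by case: s.1.
by rewrite /entry !eqxx; case: s.1.
Qed.

Lemma sym_act_ineq_mx (s : bool * 'S_4) a :
  sym_act s (ineq_mx a) = ineq_mx (act_ineq (s.1, perm_code s.2) a).
Proof.
rewrite /ineq_mx /= -!sym_act_mx; apply/matrixP => i j; rewrite !mxE.
by case: s.1.
Qed.

Lemma orbit_set_ray v :
  orbit_set (ray (mx v)) = [set ray (mx w) | w in [set` orb_vec v]].
Proof.
apply/seteqP; split=> [_ [s _ <-]|_ [_ /= /mapP[h /symsP[s ->] ->] <-]].
  exists (act_vec (s.1, perm_code s.2) v); last by rewrite sym_act_ray sym_act_mx.
  by apply/mapP; exists (s.1, perm_code s.2) => //; apply/symsP; exists s.
by exists s => //; rewrite sym_act_ray sym_act_mx.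
Qed.

Section Closed.
Variable A : seq ineq.
Hypothesis Aclosed : all (fun a => all (fun h => act_ineq h a \in A) syms) A.

Lemma orbit_set_induced a :
  orbit_set (induced (hcone (map ineq_mx A)) (ineq_mx a)) =
  [set induced (hcone (map ineq_mx A)) (ineq_mx b) | b in [set` orb_ineq a]].
Proof.
have sI s : sym_act s @` induced (hcone (map ineq_mx A)) (ineq_mx a) =
            induced (hcone (map ineq_mx A)) (ineq_mx (act_ineq (s.1, perm_code s.2) a)).
  rewrite -sym_act_ineq_mx; apply: sym_act_induced => t _ /mapP[b bA ->].
  rewrite sym_act_ineq_mx; apply: map_f; apply: (allP (allP Aclosed b bA)).
  by apply/symsP; exists t.
apply/seteqP; split=> [_ [s _ <-]|_ [_ /= /mapP[h /symsP[s ->] ->] <-]].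
  exists (act_ineq (s.1, perm_code s.2) a); last by rewrite sI.
  by apply/mapP; exists (s.1, perm_code s.2) => //; apply/symsP; exists s.
by exists s => //; rewrite sI.
Qed.

End Closed.

Lemma mx_vsum0 : mx (vsum [::]) = 0%R.
Proof. by apply/matrixP => i j; rewrite mx_entry entry_tab mxE if_same. Qed.

Lemma mx_vsum (i j : 'I_4) qs : i != j ->
  mx (vsum ((val i, val j) :: qs)) = (delta_mx i j + mx (vsum qs))%R.
Proof.
move=> ij; apply/matrixP => k l; rewrite mx_entry [RHS]mxE [delta_mx _ _ _ _]mxE.
rewrite mx_entry !entry_tab.
have [->|_] := eqVneq k l.
  by rewrite addr0; case: (l =P i) => [->|] //=; rewrite (negbTE ij).
by rewrite natrD /= xpair_eqE -!val_eqE /= (eq_sym (val i)) (eq_sym (val j)).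
Qed.

Lemma family_set (F : 'I_4 -> 'I_4 -> 'I_4 -> 'I_4 -> V)
    (f : nat -> nat -> nat -> nat -> ineq) :
  (forall i j k l : 'I_4, uniq [:: i; j; k; l] -> F i j k l = ineq_mx (f i j k l)) ->
  [set x | exists i j k l : 'I_4, uniq [:: i; j; k; l] /\ x = F i j k l] =
  ineq_mx @` [set` family f].
Proof.
move=> Ff; apply/seteqP; split=> [_ [i [j [k [l [u ->]]]]]|x [a /=]].
  exists (f i j k l); last by rewrite Ff.
  by rewrite /= mem_undup; apply/mapP; exists [:: val i; val j; val k; val l];
    rewrite ?mem_perms4.
rewrite mem_undup => /mapP[_ /perms4P[i [j [k [l [u ->]]]]] ->] <-.
by exists i, j, k, l; rewrite Ff.
Qed.

Ltac uniq4 u := move: u; rewrite /= !inE !negb_or -!andbA;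
  case/and5P=> ? ? ? ? /and3P[? ? _].

Ltac expand := rewrite /ineq_mx /= !mx_vsum ?mx_vsum0; first [done | by rewrite eq_sym | idtac].

Lemma OT_code (i j k l : 'I_4) : uniq [:: i; j; k; l] -> OT R i j k = ineq_mx (ot_code i j k l).
Proof. by move=> u; uniq4 u; expand; rewrite /OT !addr0. Qed.

Lemma NN_code (i j k l : 'I_4) : uniq [:: i; j; k; l] -> NN R i j = ineq_mx (nn_code i j k l).
Proof. by move=> u; uniq4 u; expand; rewrite /NN addr0 subr0. Qed.

Lemma A4_code (i j k l : 'I_4) : uniq [:: i; j; k; l] -> A4 R i j k l = ineq_mx (a4_code i j k l).
Proof. by move=> u; uniq4 u; expand; rewrite /A4 /B4 !addr0 !opprD !addrA. Qed.

Lemma B4_code (i j k l : 'I_4) : uniq [:: i; j; k; l] -> B4 R i j k l = ineq_mx (b4_code i j k l).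
Proof. by move=> u; uniq4 u; expand; rewrite /A4 /B4 !addr0 !opprD !addrA. Qed.

Lemma B4r_code (i j k l : 'I_4) :
  uniq [:: i; j; k; l] -> (B4 R i j k l)^T%R = ineq_mx (b4r_code i j k l).
Proof.
move=> u; uniq4 u; expand.
set rhs := (X in _ = X); rewrite /B4 !linearB !linearD /= !trmx_delta.
by rewrite /rhs !addr0 !opprD !addrA.
Qed.

Lemma OT_set : OT_ineqs R 4 = ineq_mx @` [set` OTs].
Proof.
rewrite -(family_set OT_code); apply/seteqP.
split=> [_ [i [j [k [u ->]]]]|_ [i [j [k [l [u ->]]]]]].
  (* The codes use four labels; the missing one is the remaining point. *)
  have [//|l lu] := @fresh4 [:: i; j; k]; exists i, j, k, l; split=> //.
  by rewrite -[_ :: _]/(rcons [:: i; j; k] l) rcons_uniq lu.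
exists i, j, k; split=> //.
by move: u; rewrite -[[:: i; j; k; l]]/(rcons [:: i; j; k] l) rcons_uniq => /andP[].
Qed.

Lemma NN_set : NN_ineqs R 4 = ineq_mx @` [set` NNs].
Proof.
rewrite -(family_set NN_code); apply/seteqP.
split=> [_ [i [j [ij ->]]]|_ [i [j [k [l [u ->]]]]]]; last first.
  by exists i, j; split=> //; uniq4 u.
have [//|k ku] := @fresh4 [:: i; j]; have [//|l lu] := @fresh4 [:: i; j; k].
exists i, j, k, l; split=> //.
rewrite -[[:: i; j; k; l]]/(rcons (rcons [:: i; j] k) l) !rcons_uniq lu ku /=.
by rewrite inE ij.
Qed.

Lemma A4_set : A4_ineqs R 4 = ineq_mx @` [set` A4s].
Proof. exact: (family_set A4_code). Qed.

Lemma B4_set : B4_ineqs R 4 = ineq_mx @` [set` B4s].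
Proof.
rewrite /B4s image_seq_undup image_seq_cat.
apply: etrans (congr2 setU (family_set B4_code) (family_set B4r_code)).
apply/seteqP; split.
  by move=> _ [i [j [k [l [u [->|->]]]]]]; [left|right]; exists i, j, k, l.
move=> _ [|] [i [j [k [l [u ->]]]]]; exists i, j, k, l; split=> //; by [left|right].
Qed.

Lemma QMET_hcone : QMET R 4 = hcone (map ineq_mx (OTs ++ NNs)).
Proof.
have OTE d (i j k : 'I_4) : uniq [:: i; j; k] ->
    pairing (OT R i j k) d = (d i k + d k j - d i j)%R.
  rewrite /= !inE !negb_or andbT => /andP[/andP[ij ik] jk].
  by rewrite pairingC linearB linearD /= !(pairingC d) !pairing_delta // eq_sym.
apply/seteqP; split=> d.
  move=> [d0 dOT dNN]; split=> // _ /mapP[a + ->]; rewrite mem_cat => /orP[] aA.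
    have [i [j [k [u ->]]]] : OT_ineqs R 4 (ineq_mx a) by rewrite OT_set; exists a.
    by rewrite OTE // dOT.
  have [i [j [u ->]]] : NN_ineqs R 4 (ineq_mx a) by rewrite NN_set; exists a.
  by rewrite pairing_delta // dNN.
move=> [d0 dA]; split=> // [i j k u|i j ij].
  have : OT_ineqs R 4 (OT R i j k) by exists i, j, k.
  rewrite OT_set => -[a aA aE]; rewrite -OTE // -aE; apply: dA.
  by apply: map_f; rewrite mem_cat; apply/orP; left.
have : NN_ineqs R 4 (NN R i j) by exists i, j.
rewrite NN_set => -[a aA aE]; rewrite -(pairing_delta d ij) -[delta_mx _ _]aE.
by apply: dA; apply: map_f; rewrite mem_cat; apply/orP; right.
Qed.

(** * Multi-cuts *)

(** A ranking [f] sends each point to the position of its part, so this is the multi-cut of its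
    level sets. *)
Definition ranking_vec (f : seq nat) : vec :=
  tab (fun i j => nat_of_bool (nth 0 f i < nth 0 f j)).

Definition levels (f : seq nat) (m : nat) : seq {set 'I_4} :=
  [seq [set i : 'I_4 | nth 0 f i == k]%SET | k <- iota 0 m].

Lemma multicut_levels f m : (forall i : 'I_4, nth 0 f i < m) ->
  multicut R (levels f m) = mx (ranking_vec f).
Proof.
move=> fm; apply/matrixP => i j; rewrite mxE mx_entry entry_tab.
have sm : size (levels f m) = m by rewrite size_map size_iota.
have nthl p : p < m -> nth finset.set0 (levels f m) p = [set i : 'I_4 | nth 0 f i == p]%SET.
  by move=> pm; rewrite (nth_map 0) ?size_iota // nth_iota.
transitivity ((nth 0 f i < nth 0 f j)%:R%R : R); last first.
  by case: (eqVneq i j) => [->|//]; rewrite ltnn.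
congr (nat_of_bool _)%:R%R; apply/existsP/idP => [[p /existsP[q /and3P[pq]]]|fij].
  rewrite !nthl; first by rewrite !inE => /eqP-> /eqP->.
    by rewrite -[X in _ < X]sm.
  by rewrite -[X in _ < X]sm.
have li : nth 0 f i < size (levels f m) by rewrite sm.
have lj : nth 0 f j < size (levels f m) by rewrite sm.
exists (Ordinal li); apply/existsP; exists (Ordinal lj).
by rewrite /= fij !nthl // !inE !eqxx.
Qed.

Definition top_rank (f : seq nat) := foldr maxn 0 f.

(** The filter asks that the values fill an initial segment, so that no level is empty. *)
Definition rankings : seq (seq nat) :=
  [seq f <- [seq a :: s | a <- iota 0 4, s <- [seq b :: t | b <- iota 0 4,
              t <- [seq [:: c; d] | c <- iota 0 4, d <- iota 0 4]]]
     | all [in f] (iota 0 (top_rank f))].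

Definition cut_vecs : seq vec :=
  [seq v <- map ranking_vec rankings | has (leq 1) v].

End Families.

Lemma mem_off_diag (i j : 'I_4) : i != j -> (val i, val j) \in off_diag.
Proof. by elim/ord4P: i; elim/ord4P: j. Qed.

Lemma off_diagP q : q \in off_diag ->
  exists i j : 'I_4, i != j /\ q = (val i, val j).
Proof.
case/allpairsPdep => i [j [+ + ->]]; rewrite mem_filter !mem_iota /=.
move=> i4 /andP[ji j4]; exists (Ordinal i4), (Ordinal j4).
by rewrite -val_eqE eq_sym.
Qed.

Lemma leq_top f k : k \in f -> k <= top_rank f.
Proof.
elim: f => // x f IH; rewrite inE /= leq_max => /predU1P[->|/IH->].
  by rewrite leqnn.
by rewrite orbT.
Qed.

Lemma top_mem f : f != [::] -> top_rank f \in f.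
Proof.
elim: f => // x [|y f] IH _ /=; first by rewrite maxn0 mem_head.
rewrite inE; have [_|_] := leqP x (maxn y (top_rank f)); last by rewrite eqxx.
by rewrite (IH isT) orbT.
Qed.

Lemma rankingsP f : f \in rankings ->
  [/\ size f = 4, forall i : 'I_4, nth 0 f i <= top_rank f
    & forall k, k <= top_rank f -> exists i : 'I_4, nth 0 f i = k].
Proof.
rewrite mem_filter => /andP[/allP ftop].
case/allpairsP => p [_ /allpairsP[q [_ /allpairsP[r [_ _ rE]] qE]] E].
have sf : size f = 4 by rewrite E qE rE.
split=> // [i|k kt]; first by apply/leq_top/mem_nth; rewrite sf.
have /(nthP 0)[i i4 <-] : k \in f.
  move: kt; rewrite leq_eqVlt => /predU1P[->|kt]; first by rewrite top_mem // E.
  by apply: ftop; rewrite mem_iota.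
by rewrite sf in i4; exists (Ordinal i4).
Qed.

Section Cuts.
Variable R : realFieldType.
Local Notation mx := (mx_of_coords R).

Lemma cut_vecs_sub v : v \in cut_vecs -> nonzero_multicuts R 4 (mx v).
Proof.
rewrite mem_filter => /andP[/hasP[x xv x1] /mapP[f fr vE]].
have [sf ftop topf] := rankingsP fr.
have [i [j [ij fij]]] : exists i j : 'I_4, i != j /\ nth 0 f i < nth 0 f j.
  move: xv x1; rewrite vE => /mapP[q /off_diagP[i [j [ij ->]]] ->] /=.
  by rewrite lt0b => fij; exists i, j.
split.
  apply/eqP => /matrixP/(_ i j)/eqP.
  by rewrite mx_entry vE entry_tab (negbTE ij) fij mxE oner_eq0.
(* Non-empty levels are pairwise distinct, and none of them is the empty set. *)
have memL k : k <= top_rank f -> exists i : 'I_4, i \in [set i : 'I_4 | nth 0 f i == k]%SET.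
  by case/topf => l lk; exists l; rewrite inE lk.
exists (levels f (top_rank f).+1); split.
- apply/andP; split.
    rewrite map_inj_in_uniq ?iota_uniq // => k l; rewrite !mem_iota /= !ltnS.
    by move=> /memL[u uk] _ E; move: (uk); rewrite E !inE => /eqP<-; move: uk; rewrite inE => /eqP.
  apply/and3P; split.
  + apply/eqP/setP => u; rewrite inE; apply/bigcupP.
    exists [set i : 'I_4 | nth 0 f i == nth 0 f u]%SET; last by rewrite inE.
    by rewrite inE; apply/mapP; exists (nth 0 f u); rewrite // mem_iota ltnS ftop.
  + apply/finset.trivIsetP => X Y; rewrite inE => /mapP[k _ ->].
    rewrite inE => /mapP[l _ ->] kl.
    rewrite -setI_eq0; apply/eqP/setP => u; rewrite !inE.
    by apply/negbTE; apply: contraNN kl => /andP[/eqP-> /eqP->].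
  + rewrite inE; apply/mapP => -[k]; rewrite mem_iota ltnS => /memL[u uk] E.
    by rewrite -E inE in uk.
- by rewrite size_map size_iota ltnS (leq_trans _ (ftop j)) // (leq_trans _ fij).
- by rewrite vE multicut_levels // => u; rewrite ltnS.
Qed.

Lemma ordered_partition_levels (s : seq {set 'I_4}) : ordered_partition s ->
  exists2 f, f \in rankings &
    s = levels f (size s) /\ forall i : 'I_4, nth 0 f i < size s.
Proof.
move=> /andP[us /and3P[/eqP cov /finset.trivIsetP triv n0]].
(* The position of the first part containing [i]; by disjointness it is the only one. *)
pose r (i : 'I_4) := find (fun X : {set 'I_4} => i \in X) s.
have hasr i : has (fun X : {set 'I_4} => i \in X) s.
  have : i \in finset.cover [set X in s]%SET by rewrite cov inE.
  by case/bigcupP => X; rewrite inE => Xs iX; apply/hasP; exists X.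
have rlt i : r i < size s by rewrite -has_find.
have rE i p : p < size s -> (i \in nth finset.set0 s p) = (r i == p).
  move=> ps; apply/idP/eqP => [ip|<-]; last exact: (nth_find _ (hasr i)).
  apply/eqP; rewrite -(nth_uniq finset.set0 (rlt i) ps us).
  apply: contraT => neq.
  have := triv (nth finset.set0 s (r i)) (nth finset.set0 s p).
  rewrite !inE !mem_nth // => /(_ isT isT neq).
  rewrite -setI_eq0 => /eqP/setP/(_ i).
  by rewrite !inE ip (nth_find _ (hasr i)).
pose f := map r [:: o0; o1; o2; o3].
have nf (i : 'I_4) : nth 0 f i = r i by elim/ord4P: i.
have fin k : k < size s -> k \in f.
  move=> ks; have : nth finset.set0 s k != finset.set0.
    by apply: contraNneq n0 => <-; rewrite inE mem_nth.
  case/set0Pn => i; rewrite rE // => /eqP <-; apply: map_f.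
  by elim/ord4P: i.
have ffs k : k \in f -> k < size s by case/mapP => i _ ->.
(* Every position is a value of [f], so there are at most four parts, and the values of [f] fall in
   the enumerated range. *)
have s4 : size s <= 4.
  rewrite -(size_iota 0 (size s)) -[4]/(size f); apply: uniq_leq_size.
    exact: iota_uniq.
  by move=> k; rewrite mem_iota => /fin.
exists f.
  rewrite mem_filter; apply/andP; split.
    apply/allP => k; rewrite mem_iota => /andP[_ kt]; apply: fin.
    by apply: ltn_trans kt _; apply/ffs/top_mem.
  have i4 i : r i \in iota 0 4 by rewrite mem_iota (leq_trans (rlt i)).
  apply/allpairsP; exists (r o0, [:: r o1; r o2; r o3]); split; [exact: i4| |by []].
  apply/allpairsP; exists (r o1, [:: r o2; r o3]); split; [exact: i4| |by []].
  by apply/allpairsP; exists (r o2, r o3); split; [exact: i4|exact: i4|].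
split=> [|i]; last by rewrite nf.
apply: (@eq_from_nth _ finset.set0) => [|p ps]; first by rewrite size_map size_iota.
rewrite (nth_map 0) ?size_iota // nth_iota //; apply/setP => i.
by rewrite inE nf rE.
Qed.

Lemma cuts_set : nonzero_multicuts R 4 = mx @` [set` cut_vecs].
Proof.
apply/seteqP; split=> [d [d0 [s [sp _ dE]]]|_ [v vc <-]]; last exact: cut_vecs_sub.
have [f fr [sE fs]] := ordered_partition_levels sp.
rewrite sE multicut_levels // in dE.
exists (ranking_vec f) => //=; rewrite mem_filter map_f // andbT.
apply: contraNT d0; rewrite -all_predC => /allP f0.
apply/eqP; rewrite dE; apply/matrixP => i j; rewrite mx_entry entry_tab mxE.
have [//|ij] := eqVneq i j.
have /f0 : nat_of_bool (nth 0 f i < nth 0 f j) \in ranking_vec f.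
  by apply/mapP; exists (val i, val j); rewrite ?mem_off_diag.
by rewrite /= -leqNgt leqn0 => /eqP->.
Qed.

End Cuts.

Lemma map_sub_mask (T : eqType) (p q : pred T) s :
  {in s, forall x, p x -> q x} -> sub_mask (map p s) (map q s).
Proof.
elim: s => //= x s IH pq; rewrite IH => [|y ys]; last first.
  by apply: pq; rewrite inE ys orbT.
by have := pq x (mem_head _ _); case: (p x) (q x) => [] [] // /(_ isT).
Qed.

Lemma uniq_map_inj_in (T U : eqType) (f : T -> U) s :
  uniq (map f s) -> {in s &, injective f}.
Proof.
elim: s => // x s IH /= /andP[fx /IH inj] y z.
rewrite !inE => /predU1P[->|ys] /predU1P[->|zs] // E.
- by rewrite E map_f in fx.
- by rewrite -E map_f in fx.
- exact: inj.
Qed.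

(** * Certificates *)

Definition sub_face (F : seq gen) i := [seq r <- F | nth false r.2 i].

(* The index of an inequality whose zero set in F is a largest proper one:
   it cuts out a facet of the face spanned by F. *)
Definition largest_cut (F : seq gen) (m : nat) : nat :=
  (foldl (fun best i => let k := size (sub_face F i) in
            if (best.1 <= k) && (k < size F) then (k, i) else best)
         (0, 0) (iota 0 m)).2.

Definition no_ineq : ineq := ([::], [::]).

(** A generator off the cut, paired with the inequality of the cut. The greedy search and its
    default values are not trusted: [facet_check] verifies the resulting flag. *)
Definition cut_face A (F : seq gen) i : vec * ineq :=
  ((head ([::], [::]) [seq r <- F | ~~ nth false r.2 i]).1, nth no_ineq A i).

Fixpoint descend (A : seq ineq) (k : nat) (F : seq gen) : seq (vec * ineq) :=
  if k is k'.+1 then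
    let i := largest_cut F (size A) in
    cut_face A F i :: descend A k' (sub_face F i)
  else [::].

Lemma size_descend A k F : size (descend A k F) = k.
Proof. by elim: k F => //= k IH F; rewrite IH. Qed.

Fixpoint flagb (l : seq (vec * ineq)) : bool :=
  if l is (g, b) :: l' then
    [&& ~~ tight b g, all (fun q => tight b q.1) l' & flagb l']
  else true.

Definition facet_check A (D : seq gen) (i : nat) : bool :=
  let l := descend A 11 (sub_face D i) in
  flagb (cut_face A D i :: l) &&
  all (fun q => [&& q.1 \in map fst D & q.2 \in A]) (cut_face A D i :: l).

Definition maximal_check (D : seq gen) : bool :=
  all (fun r => all (fun s => sub_mask r.2 s.2 ==> (s.1 == r.1)) D) D.

(** Inequalities with distinct incidence rows induce distinct faces. *)
Definition incidence_check A (D : seq gen) : bool :=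
  uniq [seq [seq tight a r.1 | r <- D] | a <- A].

(** Boolean form of the combinatorial hypotheses of [orbits_image] and [card_orbits]. *)
Definition orbit_check (T : eqType) (orb : T -> seq T) (L reps : seq T) : bool :=
  let orbs := map orb reps in
  [&& uniq reps, all [in L] reps, all (fun o => all [in L] o) orbs,
      all (fun c => has (fun o : seq T => c \in o) orbs) L
    & all (fun r => all (fun r' => (r' \in orb r) ==> (r' == r)) reps) reps].

(** * Rays, facets and orbits read off from checked data *)

Section Certified.
Variable R : realFieldType.
Local Notation V := 'M[R]_4.
Local Notation mx := (mx_of_coords R).
Local Notation ineq_mx := (@ineq_mx R).
Variables (A : seq ineq) (D : seq gen).
Hypotheses (sA : all small A) (goodD : {in D, forall r, good_gen A r})
  (genD : generates (map ineq_mx A) (mxs R D)).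
Local Notation C := (hcone (map ineq_mx A)).
Local Notation G := (map fst D).

Lemma mxs_fst : mxs R D = map mx G.
Proof. by rewrite -map_comp. Qed.

Lemma mx_in_cone g : g \in G -> C (mx g).
Proof. by move=> gG; apply: (gen_in genD); rewrite mxs_fst map_f. Qed.

Lemma hcone_conic_hull : C = conic_hull (mx @` [set` G]).
Proof.
rewrite (hcone_hull genD) mxs_fst; congr conic_hull.
apply/seteqP; split=> [_ /= /mapP[g gG ->]|_ [g gG <-]]; first by exists g.
exact: map_f.
Qed.

Section Rays.
Hypothesis Dmax : maximal_check D.

Lemma carries_maximal g h : g \in G -> h \in G ->
  carries (map ineq_mx A) (mx g) (mx h) -> h = g.
Proof.
move=> /mapP[r rD ->] /mapP[s sD ->] gh; apply/eqP.
apply: (implyP (allP (allP Dmax r rD) s sD)).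
have /and4P[_ /eqP-> _ _] := goodD rD; have /and4P[_ /eqP-> _ _] := goodD sD.
apply: map_sub_mask => a aA; have sa := allP sA a aA.
by rewrite -!(tightE R) // => /eqP ar; apply/eqP/gh => //; exact: map_f.
Qed.

Lemma extreme_rays_code : extreme_rays C = (fun v => ray (mx v)) @` [set` G].
Proof.
rewrite (extreme_rays_hcone genD); last first.
  move=> _ _ /[!mxs_fst] /mapP[g gG ->] /mapP[h hG ->] gh.
  by rewrite (carries_maximal gG hG gh).
rewrite mxs_fst; apply/seteqP.
split=> [_ [_ /= /mapP[g gG ->] <-]|_ [g gG <-]]; first by exists g.
by exists (mx g) => //; exact: map_f.
Qed.

(** Generators of one ray share their tight inequalities, and maximality identifies them. *)
Lemma ray_code_inj : {in G &, injective (fun v => ray (mx v))}.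
Proof.
move=> g h gG hG E; apply/esym/carries_maximal => //.
have : ray (mx g) (mx h).
  by rewrite E; exists 1%R => /=; rewrite ?ler01 ?scale1r.
by move=> [t _ <-] a _ ag; rewrite linearZ /= ag mulr0.
Qed.

Lemma card_extreme_rays : uniq G -> (extreme_rays C #= `I_(size G))%card.
Proof.
by move=> uG; rewrite extreme_rays_code; apply: card_image_seq => //; exact: ray_code_inj.
Qed.

Variable reps : seq vec.
Hypothesis oc : orbit_check orb_vec G reps.

Lemma orbits_extreme_rays :
  (orbits (extreme_rays C) #= `I_(size reps))%card /\
  orbits (extreme_rays C) = [set orbit_set (ray (mx v)) | v in [set` reps]].
Proof.
have /and5P[ur /allP rG /allP oG /allP Go /allP sep] := oc.
have oG' r : r \in reps -> {subset orb_vec r <= G}.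
  by move=> rr; apply/allP/oG/map_f.
have Go' c : c \in G -> exists2 r, r \in reps & c \in orb_vec r.
  by move=> /Go /hasP[_ /mapP[r rr ->] cr]; exists r.
have sep' r r' : r \in reps -> r' \in reps -> r' \in orb_vec r -> r' = r.
  by move=> /sep/allP H /H/implyP H' /H'/eqP.
rewrite extreme_rays_code; split; last first.
  exact: (orbits_image (fun c _ => orbit_set_ray R c) rG Go').
exact: (card_orbits ray_code_inj (fun c _ => orbit_set_ray R c) rG oG' Go' ur sep').
Qed.

End Rays.

Section Facets.
Hypothesis Dfacets : all (facet_check A D) (iota 0 (size A)).
Hypothesis Ainc : incidence_check A D.
Hypothesis A0 : A != [::].

Let mflag (l : seq (vec * ineq)) : seq (V * V) := [seq (mx q.1, ineq_mx q.2) | q <- l].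

Lemma flagb_flag l : all (fun q => q.2 \in A) l -> flagb l -> flag (mflag l).
Proof.
elim: l => //= -[g b] l IH /= /andP[bA lA] /and3P[bg bl fl].
have sb := allP sA b bA; split; last exact: IH.
  by rewrite tightE.
by move=> _ /mapP[q ql ->]; apply/eqP; rewrite tightE // (allP bl).
Qed.

Lemma zero_diag_span (x : V) : zero_diag x ->
  x \in <<[seq mx (vsum [:: q]) | q <- off_diag]>>%VS.
Proof.
move=> x0; rewrite (matrix_sum_delta x); apply: memv_suml => i _.
apply: memv_suml => j _; have [->|ij] := eqVneq i j; first by rewrite x0 scale0r mem0v.
apply/memvZ/memv_span/mapP; exists (val i, val j); first exact: mem_off_diag.
by rewrite mx_vsum // mx_vsum0 addr0.
Qed.

(** The checked flag begins with [a]: its 12 vectors give the dimension of the cone, and the last 11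
    lie in the face. *)
Lemma facet_dims a : a \in A ->
  has_dim C 12 /\ has_dim (induced C (ineq_mx a)) 11.
Proof.
move=> aA; have ia : index a A < size A by rewrite index_mem.
have : facet_check A D (index a A) by apply: (allP Dfacets); rewrite mem_iota.
rewrite /facet_check; have aE : (cut_face A D (index a A)).2 = a by rewrite /= nth_index.
(* Only the length of the flag and its checked properties matter; how it was found is abstracted
   away. *)
move: (size_descend A 11 (sub_face D (index a A))).
move: (descend _ _ _) (cut_face _ _ _) aE => l [g b] /= -> {b} sl'.
move=> /andP[fl /andP[/andP[gG _] /allP lG]].
have sl : size (mflag l) = 11 by rewrite size_map.
have fm : flag (mflag ((g, a) :: l)).
  by apply: flagb_flag => //=; rewrite aA; apply/allP => q /lG/andP[].
have lC q : q \in mflag l -> C q.1.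
  by case/mapP=> p /lG/andP[pG _] ->; exact: mx_in_cone.
have sE : size [seq mx (vsum [:: q]) | q <- off_diag] = 12 by rewrite size_map.
split.
  exact: (flag_has_dim_hcone sE zero_diag_span fm sl (mx_in_cone gG) lC).
exact: (flag_has_dim_induced sE zero_diag_span fm sl (mx_in_cone gG) lC).
Qed.

Local Notation F := (fun a => induced C (ineq_mx a)).

Lemma facets_code : facets C = F @` [set` A].
Proof.
have [a aA] : exists a, a \in A.
  by case: (A) A0 => // a s _; exists a; rewrite mem_head.
rewrite (facets_hcone (k := 11)).
- apply/seteqP; split=> [_ [_ /= /mapP[b bA ->] <-]|_ [b bA <-]]; first by exists b.
  by exists (ineq_mx b) => //; exact: map_f.
- by have [] := facet_dims aA.
- by move=> _ /mapP[b bA ->]; have [] := facet_dims bA.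
Qed.

Lemma induced_code_inj : {in A &, injective F}.
Proof.
move=> a b aA bA E; apply: (uniq_map_inj_in Ainc) => //.
apply/eq_in_map => r rD; have rC : C (mx r.1) by apply/mx_in_cone/map_f.
have sa := allP sA a aA; have sb := allP sA b bA.
rewrite -!(tightE R) //; apply/eqP/eqP => H.
  by have [] : F b (mx r.1) by rewrite -E.
by have [] : F a (mx r.1) by rewrite E.
Qed.

(** Positively proportional inequalities induce the same face, so this follows from injectivity on
    faces. *)
Lemma ineq_class_code_inj : {in A &, injective (fun a => ineq_class (ineq_mx a))}.
Proof.
move=> a b aA bA E; apply: induced_code_inj => //.
have : ineq_class (ineq_mx b) (ineq_mx a).
  by rewrite -E; exists 1%R => /=; rewrite ?ltr01 ?scale1r.
move=> [t /= t0 tE]; apply/seteqP; split=> d [dC /eqP H]; split=> //; move: H.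
  by rewrite -tE pairingC linearZ /= pairingC mulf_eq0 gt_eqF // => /eqP.
by rewrite -tE !(pairingC _ d) linearZ /= => /eqP->; rewrite mulr0.
Qed.

Lemma card_facets_sub s : uniq s -> {subset s <= A} ->
  (F @` [set` s] #= `I_(size s))%card.
Proof.
by move=> us sub; apply: card_image_seq => // a b /sub aA /sub bA; exact: induced_code_inj.
Qed.

Lemma card_classes_sub s : uniq s -> {subset s <= A} ->
  ((fun a => ineq_class (ineq_mx a)) @` [set` s] #= `I_(size s))%card.
Proof.
by move=> us sub; apply: card_image_seq => // a b /sub aA /sub bA; exact: ineq_class_code_inj.
Qed.

Hypothesis Aclosed : all (fun a => all (fun h => act_ineq h a \in A) syms) A.
Variable reps : seq ineq.
Hypothesis oc : orbit_check orb_ineq A reps.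

Lemma orbits_facets :
  (orbits (facets C) #= `I_(size reps))%card /\
  orbits (facets C) = [set F @` [set` orb_ineq r] | r in [set` reps]].
Proof.
have /and5P[ur /allP rG /allP oG /allP Go /allP sep] := oc.
have oG' r : r \in reps -> {subset orb_ineq r <= A}.
  by move=> rr; apply/allP/oG/map_f.
have Go' c : c \in A -> exists2 r, r \in reps & c \in orb_ineq r.
  by move=> /Go /hasP[_ /mapP[r rr ->] cr]; exists r.
have sep' r r' : r \in reps -> r' \in reps -> r' \in orb_ineq r -> r' = r.
  by move=> /sep/allP H /H/implyP H' /H'/eqP.
have oE c : c \in A -> orbit_set (F c) = F @` [set` orb_ineq c].
  by move=> _; exact: (orbit_set_induced R Aclosed).
rewrite facets_code; split.
  exact: (card_orbits induced_code_inj oE rG oG' Go' ur sep').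
rewrite (orbits_image oE rG Go'); apply/seteqP.
by split=> _ [r rr <-]; exists r => //; rewrite oE //; exact: rG.
Qed.

End Facets.

End Certified.

Lemma image_seq_map (T U : eqType) (W : Type) (f : U -> W) (g : T -> U) (s : seq T) :
  f @` [set` map g s] = (fun x => f (g x)) @` [set` s].
Proof.
apply/seteqP; split=> [_ [_ /= /mapP[x xs ->] <-]|_ [x xs <-]]; first by exists x.
by exists (g x) => //; exact: map_f.
Qed.

Lemma image_seq_eq (T : eqType) (U : Type) (f : T -> U) (s t : seq T) :
  s =i t -> f @` [set` s] = f @` [set` t].
Proof. by move=> st; congr image; apply/seteqP; split=> x; rewrite /= st. Qed.

Definition same_elements (T : eqType) (s t : seq T) := all [in t] s && all [in s] t.

Lemma same_elementsP (T : eqType) (s t : seq T) : same_elements s t -> s =i t.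
Proof. by case/andP=> /allP st /allP ts x; apply/idP/idP => [/st|/ts]. Qed.

(** * The two cones *)

Definition orthant_gens : seq gen :=
  [seq (vsum [:: q], [seq tight a (vsum [:: q]) | a <- NNs]) | q <- off_diag].

Definition Q_ineqs : seq ineq := OTs ++ NNs.
Definition M_ineqs : seq ineq := (A4s ++ B4s) ++ Q_ineqs.

(** Stored in normal form, so that the later checks do not rerun the double description. *)
Definition Q_gens : seq gen := Eval vm_compute in dd orthant_gens OTs.
Definition M_gens : seq gen := Eval vm_compute in dd Q_gens (A4s ++ B4s).

Definition cut_reps : seq vec :=
  map ranking_vec [:: [:: 1; 1; 1; 0]; [:: 1; 1; 0; 0]; [:: 2; 2; 1; 0];
                      [:: 2; 1; 1; 0]; [:: 3; 2; 1; 0]].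

Definition other_vecs : seq vec :=
  [:: [:: 0; 0; 0; 1; 0; 0; 1; 1; 0; 2; 1; 1];
      [:: 0; 0; 0; 1; 0; 0; 1; 1; 1; 1; 1; 1];
      [:: 0; 0; 0; 1; 0; 1; 1; 1; 1; 1; 1; 0];
      [:: 0; 0; 1; 1; 1; 1; 1; 1; 1; 1; 0; 0];
      [:: 0; 0; 1; 1; 1; 1; 1; 1; 2; 1; 0; 0]].

Definition Q_facet_reps : seq ineq := [:: ot_code 0 1 2 3; nn_code 0 1 2 3].
Definition M_facet_reps : seq ineq :=
  [:: ot_code 0 1 2 3; nn_code 0 1 2 3; a4_code 0 1 2 3; b4_code 0 1 2 3].

(** * Checks by computation *)

Lemma Q_gensE : dd orthant_gens OTs = Q_gens.
Proof. by vm_compute. Qed.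

Lemma M_gensE : dd Q_gens (A4s ++ B4s) = M_gens.
Proof. by vm_compute. Qed.

Lemma M_small : all small M_ineqs.
Proof. by vm_compute. Qed.

Lemma Q_small : all small Q_ineqs.
Proof. by vm_compute. Qed.

Lemma NN_small : all small NNs.
Proof. by vm_compute. Qed.

Lemma orthant_good : all (good_gen NNs) orthant_gens.
Proof. by vm_compute. Qed.

Lemma Q_maximal : maximal_check Q_gens.
Proof. by vm_compute. Qed.

Lemma M_maximal : maximal_check M_gens.
Proof. by vm_compute. Qed.

Lemma Q_incidence : incidence_check Q_ineqs Q_gens.
Proof. by vm_compute. Qed.

Lemma M_incidence : incidence_check M_ineqs M_gens.
Proof. by vm_compute. Qed.

Lemma Q_facet_flags : all (facet_check Q_ineqs Q_gens) (iota 0 (size Q_ineqs)).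
Proof. by vm_compute. Qed.

Lemma M_facet_flags : all (facet_check M_ineqs M_gens) (iota 0 (size M_ineqs)).
Proof. by vm_compute. Qed.

Lemma Q_closed :
  all (fun a => all (fun h => act_ineq h a \in Q_ineqs) syms) Q_ineqs.
Proof. by vm_compute. Qed.

Lemma M_closed :
  all (fun a => all (fun h => act_ineq h a \in M_ineqs) syms) M_ineqs.
Proof. by vm_compute. Qed.

Lemma Q_ray_orbits : orbit_check orb_vec (map fst Q_gens) (cut_reps ++ other_vecs).
Proof. by vm_compute. Qed.

Lemma M_ray_orbits : orbit_check orb_vec (map fst M_gens) cut_reps.
Proof. by vm_compute. Qed.

Lemma Q_facet_orbits : orbit_check orb_ineq Q_ineqs Q_facet_reps.
Proof. by vm_compute. Qed.

Lemma M_facet_orbits : orbit_check orb_ineq M_ineqs M_facet_reps.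
Proof. by vm_compute. Qed.

Lemma OT_orbit : orb_ineq (ot_code 0 1 2 3) =i OTs.
Proof. by apply: same_elementsP; vm_compute. Qed.

Lemma NN_orbit : orb_ineq (nn_code 0 1 2 3) =i NNs.
Proof. by apply: same_elementsP; vm_compute. Qed.

Lemma A4_orbit : orb_ineq (a4_code 0 1 2 3) =i A4s.
Proof. by apply: same_elementsP; vm_compute. Qed.

Lemma B4_orbit : orb_ineq (b4_code 0 1 2 3) =i B4s.
Proof. by apply: same_elementsP; vm_compute. Qed.

Lemma M_gens_cuts : map fst M_gens =i cut_vecs.
Proof. by apply: same_elementsP; vm_compute. Qed.

Lemma uniq_Q_gens : uniq (map fst Q_gens).
Proof. by vm_compute. Qed.

Lemma uniq_M_gens : uniq (map fst M_gens).
Proof. by vm_compute. Qed.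

Lemma family_uniq : [&& uniq OTs, uniq NNs, uniq A4s & uniq B4s].
Proof. by vm_compute. Qed.

Lemma family_sub_M : all (all [in M_ineqs]) [:: OTs; NNs; A4s; B4s].
Proof. by vm_compute. Qed.

Lemma family_sub_Q : all (all [in Q_ineqs]) [:: OTs; NNs].
Proof. by vm_compute. Qed.

Lemma M_ineqs_card : size M_ineqs = 72 /\ uniq M_ineqs.
Proof. by vm_compute. Qed.

Lemma Q_ineqs_card : size Q_ineqs = 36 /\ uniq Q_ineqs.
Proof. by vm_compute. Qed.

Lemma family_sizes :
  [/\ size OTs = 24, size NNs = 12, size A4s = 12 & size B4s = 24].
Proof. by vm_compute. Qed.

Lemma image_seq2 (T : eqType) (U : Type) (f : T -> U) x1 x2 y1 y2 :
  f x1 = y1 -> f x2 = y2 -> f @` [set` [:: x1; x2]] = [set y1; y2].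
Proof.
move=> <- <-; apply/seteqP; split=> [_ [x + <-]|y].
  by rewrite /= !inE => /orP[] /eqP->; [left|right].
by move=> [->|->]; [exists x1|exists x2] => //; rewrite /= !inE eqxx ?orbT.
Qed.

Lemma image_seq4 (T : eqType) (U : Type) (f : T -> U) x1 x2 x3 x4 y1 y2 y3 y4 :
  f x1 = y1 -> f x2 = y2 -> f x3 = y3 -> f x4 = y4 ->
  f @` [set` [:: x1; x2; x3; x4]] = [set y1; y2; y3; y4].
Proof.
move=> E1 E2 E3 E4; rewrite -[[:: _; _; _; _]]/([:: x1; x2] ++ [:: x3; x4]).
by rewrite image_seq_cat (image_seq2 E1 E2) (image_seq2 E3 E4) setUA.
Qed.

Lemma image_seq_cat4 (T : eqType) (U : Type) (f : T -> U) (s1 s2 s3 s4 : seq T) :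
  f @` [set` (s3 ++ s4) ++ (s1 ++ s2)] =
  f @` [set` s1] `|` f @` [set` s2] `|` f @` [set` s3] `|` f @` [set` s4].
Proof. by rewrite !image_seq_cat setUC setUA. Qed.

(** * Descriptions of both cones and their consequences *)

Section TwoCones.
Variable R : realFieldType.
Local Notation mx := (mx_of_coords R).
Local Notation ineq_mx := (@ineq_mx R).

(** A nonzero point has a nonzero entry, and the unit matrix at that entry vanishes wherever the
    point does. *)
Lemma orthant_generates : generates (map ineq_mx NNs) (mxs R orthant_gens).
Proof.
apply: (generates_good NN_small); first exact/allP/orthant_good.
move=> x [x0 xN] xn0.
have [i [j xij]] : exists i j, x i j != 0%R.
  apply: contrapT => no; case/eqP: xn0; apply/matrixP => i j; rewrite mxE.
  by apply: contrapT => /eqP xij; apply: no; exists i, j.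
have ij : i != j by apply: contraNneq xij => ->; rewrite x0.
exists (delta_mx i j).
  apply/mapP; exists (vsum [:: (val i, val j)],
    [seq tight a (vsum [:: (val i, val j)]) | a <- NNs]); last first.
    by rewrite /= mx_vsum // mx_vsum0 addr0.
  exact: (map_f _ (mem_off_diag ij)).
move=> _ /mapP[a aN ->]; have [k [l [kl ->]]] : NN_ineqs R 4 (ineq_mx a).
  by rewrite NN_set; exists a.
rewrite !pairing_delta // => xkl; rewrite mxE.
by case: eqP => //= ki; case: eqP => //= lj; rewrite -ki -lj xkl eqxx in xij.
Qed.

Lemma Q_generates : {in Q_gens, forall r, good_gen Q_ineqs r} /\
  generates (map ineq_mx Q_ineqs) (mxs R Q_gens).
Proof.
rewrite -Q_gensE; apply: generates_dd Q_small _ orthant_generates.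
exact/allP/orthant_good.
Qed.

(** The run continues from the generators of [QMET], adding the remaining two families. *)
Lemma M_generates : {in M_gens, forall r, good_gen M_ineqs r} /\
  generates (map ineq_mx M_ineqs) (mxs R M_gens).
Proof.
have [goodQ genQ] := Q_generates.
by rewrite -M_gensE; exact: generates_dd M_small goodQ genQ.
Qed.

Lemma M_gens_set : mx @` [set` map fst M_gens] = nonzero_multicuts R 4.
Proof. by rewrite cuts_set; apply/image_seq_eq/M_gens_cuts. Qed.

(** The generators computed from the inequalities are exactly the nonzero multi-cuts, so the hull
    and the half-space descriptions agree. *)
Lemma OMCUT_hcone : OMCUT R 4 = hcone (map ineq_mx M_ineqs).
Proof. by rewrite (hcone_conic_hull M_generates.2) M_gens_set. Qed.

Lemma multicut_repsE : multicut_reps R = map mx cut_reps.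
Proof.
have [p1 p2 p3 p4] : [/\ pt 1 = o0, pt 2 = o1, pt 3 = o2 & pt 4 = o3].
  by split; apply: val_inj; rewrite /= inordK.
(* Each representative is the list of levels of its ranking; equality of parts is tested at the four
   points. *)
have lev f m s : (forall i : 'I_4, nth 0 f i < m) -> s = levels f m ->
    multicut R s = mx (ranking_vec f).
  by move=> fm ->; exact: multicut_levels.
rewrite /multicut_reps /cut_reps /= p1 p2 p3 p4.
have setE (X Y : {set 'I_4}) :
    (o0 \in X) = (o0 \in Y) -> (o1 \in X) = (o1 \in Y) ->
    (o2 \in X) = (o2 \in Y) -> (o3 \in X) = (o3 \in Y) -> X = Y.
  by move=> ? ? ? ?; apply/setP; elim/ord4P.
congr [:: _; _; _; _; _]; [apply: (lev _ 2) | apply: (lev _ 2) | apply: (lev _ 3)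
  | apply: (lev _ 3) | apply: (lev _ 4)]; try by elim/ord4P.
- by rewrite /levels /=; congr [:: _; _]; apply: setE; rewrite !inE.
- by rewrite /levels /=; congr [:: _; _]; apply: setE; rewrite !inE.
- by rewrite /levels /=; congr [:: _; _; _]; apply: setE; rewrite !inE.
- by rewrite /levels /=; congr [:: _; _; _]; apply: setE; rewrite !inE.
- by rewrite /levels /=; congr [:: _; _; _; _]; apply: setE; rewrite !inE.
Qed.

Lemma other_repsE : other_reps R = map mx other_vecs.
Proof. by []. Qed.

Lemma OT_image (U : Type) (f : 'M[R]_4 -> U) :
  f @` OT_ineqs R 4 = (fun a => f (ineq_mx a)) @` [set` OTs].
Proof. by rewrite OT_set; exact: image_comp. Qed.

Lemma NN_image (U : Type) (f : 'M[R]_4 -> U) :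
  f @` NN_ineqs R 4 = (fun a => f (ineq_mx a)) @` [set` NNs].
Proof. by rewrite NN_set; exact: image_comp. Qed.

Lemma A4_image (U : Type) (f : 'M[R]_4 -> U) :
  f @` A4_ineqs R 4 = (fun a => f (ineq_mx a)) @` [set` A4s].
Proof. by rewrite A4_set; exact: image_comp. Qed.

Lemma B4_image (U : Type) (f : 'M[R]_4 -> U) :
  f @` B4_ineqs R 4 = (fun a => f (ineq_mx a)) @` [set` B4s].
Proof. by rewrite B4_set; exact: image_comp. Qed.

Local Notation QC := (hcone (map ineq_mx Q_ineqs)).
Local Notation MC := (hcone (map ineq_mx M_ineqs)).
Local Notation QF := (fun a => induced QC (ineq_mx a)).
Local Notation MF := (fun a => induced MC (ineq_mx a)).

Lemma OMCUT_rays :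
  [/\ (extreme_rays MC #= `I_74)%card,
      extreme_rays MC = [set ray d | d in nonzero_multicuts R 4],
      (orbits (extreme_rays MC) #= `I_5)%card
    & orbits (extreme_rays MC) =
        [set orbit_set (ray d) | d in [set` multicut_reps R]]].
Proof.
have [goodM genM] := M_generates.
have [co oE] := orbits_extreme_rays M_small goodM genM M_maximal M_ray_orbits.
split=> //.
- exact: (card_extreme_rays M_small goodM genM M_maximal uniq_M_gens).
- rewrite (extreme_rays_code M_small goodM genM M_maximal) -M_gens_set.
  by rewrite image_comp.
- by rewrite oE multicut_repsE; apply/esym/image_seq_map.
Qed.

Lemma QMET_rays :
  [/\ (extreme_rays QC #= `I_164)%card,
      (orbits (extreme_rays QC) #= `I_10)%card
    & orbits (extreme_rays QC) =
        orbits (extreme_rays MC) `|`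
        [set orbit_set (ray d) | d in [set` other_reps R]]].
Proof.
have [goodQ genQ] := Q_generates.
have [co oE] := orbits_extreme_rays Q_small goodQ genQ Q_maximal Q_ray_orbits.
split=> //; first exact: (card_extreme_rays Q_small goodQ genQ Q_maximal uniq_Q_gens).
have [_ _ _ ->] := OMCUT_rays; rewrite oE image_seq_cat multicut_repsE other_repsE.
by apply/esym; congr setU; exact: image_seq_map.
Qed.

Lemma M_cards (s : seq ineq) : uniq s -> all [in M_ineqs] s ->
  ((fun a => ineq_class (ineq_mx a)) @` [set` s] #= `I_(size s))%card /\
  (MF @` [set` s] #= `I_(size s))%card.
Proof.
move=> us /allP sub; have [_ genM] := M_generates.
split.
  exact: (card_classes_sub M_small genM M_incidence us sub).
exact: (card_facets_sub M_small genM M_incidence us sub).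
Qed.

Lemma OMCUT_facets :
  [/\ (facets MC #= `I_72)%card /\
        facets MC = MF @` [set` OTs] `|` MF @` [set` NNs]
                    `|` MF @` [set` A4s] `|` MF @` [set` B4s]
    & (orbits (facets MC) #= `I_4)%card /\
        orbits (facets MC) =
          [set MF @` [set` OTs]; MF @` [set` NNs];
               MF @` [set` A4s]; MF @` [set` B4s]]].
Proof.
have [_ genM] := M_generates.
have M0 : M_ineqs != [::] by rewrite -size_eq0 M_ineqs_card.1.
have FE := facets_code M_small genM M_facet_flags M0.
split; last first.
  have [co oE] := orbits_facets M_small genM M_facet_flags M_incidence M0 M_closed
                    M_facet_orbits.
  split; first exact: co.
  rewrite oE; apply: image_seq4; apply: image_seq_eq.
  - exact: OT_orbit.
  - exact: NN_orbit.
  - exact: A4_orbit.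
  - exact: B4_orbit.
split.
  have [sM uM] := M_ineqs_card; rewrite FE -sM.
  by apply: (card_facets_sub M_small genM M_incidence uM).
by rewrite FE; exact: (image_seq_cat4 _ OTs NNs A4s B4s).
Qed.

Lemma QMET_facets :
  [/\ (facets QC #= `I_36)%card,
      facets QC = QF @` [set` OTs] `|` QF @` [set` NNs],
      (orbits (facets QC) #= `I_2)%card /\
        orbits (facets QC) = [set QF @` [set` OTs]; QF @` [set` NNs]],
      (QF @` [set` OTs] #= `I_24)%card
    & (QF @` [set` NNs] #= `I_12)%card].
Proof.
have [_ genQ] := Q_generates.
have Q0 : Q_ineqs != [::] by rewrite -size_eq0 Q_ineqs_card.1.
have FE := facets_code Q_small genQ Q_facet_flags Q0.
have [s1 s2 _ _] := family_sizes; have /and4P[u1 u2 _ _] := family_uniq.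
have cf s := @card_facets_sub _ _ _ Q_small genQ Q_incidence s.
have /and3P[/allP sub1 /allP sub2 _] := family_sub_Q.
split.
- have [sQ uQ] := Q_ineqs_card; rewrite FE -sQ.
  by apply: cf.
- by rewrite FE; exact: image_seq_cat.
- have [co oE] := orbits_facets Q_small genQ Q_facet_flags Q_incidence Q0 Q_closed
                    Q_facet_orbits.
  split; first exact: co.
  rewrite oE; apply: image_seq2; apply: image_seq_eq.
  + exact: OT_orbit.
  + exact: NN_orbit.
- by have := cf OTs u1 sub1; rewrite s1.
- by have := cf NNs u2 sub2; rewrite s2.
Qed.

End TwoCones.

Local Open Scope ring_scope.

Theorem mainTheorem2 (R : realType) :
  [/\ (* (1) *)
      [/\ (extreme_rays (OMCUT R 4) #= `I_74)%card,
          extreme_rays (OMCUT R 4) = [set ray d | d in nonzero_multicuts R 4],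
          (orbits (extreme_rays (OMCUT R 4)) #= `I_5)%card
        & orbits (extreme_rays (OMCUT R 4)) =
            [set orbit_set (ray d) | d in [set` multicut_reps R]]],
      (* (2) *)
      [/\ (facets (OMCUT R 4) #= `I_72)%card /\
            facets (OMCUT R 4) =
              [set induced (OMCUT R 4) a
                 | a in OT_ineqs R 4 `|` NN_ineqs R 4
                        `|` A4_ineqs R 4 `|` B4_ineqs R 4],
          (orbits (facets (OMCUT R 4)) #= `I_4)%card /\
            orbits (facets (OMCUT R 4)) =
              [set [set induced (OMCUT R 4) a | a in OT_ineqs R 4];
                   [set induced (OMCUT R 4) a | a in NN_ineqs R 4];
                   [set induced (OMCUT R 4) a | a in A4_ineqs R 4];
                   [set induced (OMCUT R 4) a | a in B4_ineqs R 4]],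
          [/\ ([set ineq_class a | a in OT_ineqs R 4] #= `I_24)%card,
              ([set ineq_class a | a in NN_ineqs R 4] #= `I_12)%card,
              ([set ineq_class a | a in A4_ineqs R 4] #= `I_12)%card
            & ([set ineq_class a | a in B4_ineqs R 4] #= `I_24)%card]
        & [/\ ([set induced (OMCUT R 4) a | a in OT_ineqs R 4] #= `I_24)%card,
              ([set induced (OMCUT R 4) a | a in NN_ineqs R 4] #= `I_12)%card,
              ([set induced (OMCUT R 4) a | a in A4_ineqs R 4] #= `I_12)%card
            & ([set induced (OMCUT R 4) a | a in B4_ineqs R 4] #= `I_24)%card]],
      (* (3) *)
      [/\ (facets (QMET R 4) #= `I_36)%card,
          facets (QMET R 4) =
            [set induced (QMET R 4) a | a in OT_ineqs R 4 `|` NN_ineqs R 4],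
          (orbits (facets (QMET R 4)) #= `I_2)%card /\
            orbits (facets (QMET R 4)) =
              [set [set induced (QMET R 4) a | a in OT_ineqs R 4];
                   [set induced (QMET R 4) a | a in NN_ineqs R 4]],
          ([set induced (QMET R 4) a | a in OT_ineqs R 4] #= `I_24)%card
        & ([set induced (QMET R 4) a | a in NN_ineqs R 4] #= `I_12)%card]
    & (* (4) *)
      [/\ (extreme_rays (QMET R 4) #= `I_164)%card,
          (orbits (extreme_rays (QMET R 4)) #= `I_10)%card
        & orbits (extreme_rays (QMET R 4)) =
            orbits (extreme_rays (OMCUT R 4)) `|`
            [set orbit_set (ray d) | d in [set` other_reps R]]]].
Proof.
rewrite OMCUT_hcone QMET_hcone !image_setU.
rewrite !OT_image !NN_image !A4_image !B4_image.
have [s1 s2 s3 s4] := family_sizes; have /and4P[u1 u2 u3 u4] := family_uniq.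
have /and5P[m1 m2 m3 m4 _] := family_sub_M.
have [c1 f1] := M_cards R u1 m1; have [c2 f2] := M_cards R u2 m2.
have [c3 f3] := M_cards R u3 m3; have [c4 f4] := M_cards R u4 m4.
rewrite s1 in c1 f1; rewrite s2 in c2 f2; rewrite s3 in c3 f3; rewrite s4 in c4 f4.
have [mf mo] := OMCUT_facets R.
split; [exact: OMCUT_rays | | exact: QMET_facets | exact: QMET_rays].
split; [exact: mf | exact: mo | |].
  by split; [exact: c1 | exact: c2 | exact: c3 | exact: c4].
by split; [exact: f1 | exact: f2 | exact: f3 | exact: f4].
Qed.
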